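(* Let $D\in\mathbb{R}^{m\times n}$, $S\in\mathcal{S}(D)$, $a>0$, $\eta\in(0,1)$, $t\in(0,(n-1)/2-\log(2(n-r_S)))$, and choose $$\lambda_0\ge\frac{1}{1-\eta}\,\gamma\sqrt{\frac{2\log(2(n-r_S))+2t}{n-1}} .$$ Assume that $n>8a$, that $\lambda_0\ge R/(1-\eta)$ for some $R>0$, that $$\|Df^0\|_1\le \frac{c\,\sigma\sqrt{1-\sqrt{8a/n}}}{\lambda_0},\qquad c=\sqrt{\left(\frac{\eta}{2}-\frac{\sqrt{r_S}+\sqrt{2a}}{\sqrt{n-\sqrt{8an}}}\right)^2+4}-2,$$ and that $S$ satisfies $$\eta>2\,\frac{\sqrt{r_S}+\sqrt{2a}}{\sqrt{n-\sqrt{8an}}} .$$ Then for all $f\in\mathbb{R}^n$ it holds that, with probability at least $1-4e^{-a}-e^{-t}$, $$\|\hat f_{\sqrt{}}-f^0\|_n^2\le\|f-f^0\|_n^2+16\sigma\lambda_0\|D_{-S}f\|_1+\sigma^2\left(\sqrt{\frac{2a}{n}}+\sqrt{\frac{r_S}{n}}+\frac{4\lambda_0\sqrt{r_S}}{\kappa(S,W)}\right)^2 .$$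
   Context: Model: $f^0\in\mathbb{R}^n$ is a fixed signal and one observes $Y=f^0+\epsilon$ with $\epsilon\sim\mathcal{N}_n(0,\sigma^2 \mathrm{I}_n)$, $\sigma\in(0,\infty)$. For $f\in\mathbb{R}^n$, $\|f\|_n^2=\sum_{i=1}^n f_i^2/n$. The square root analysis estimator is $\hat f_{\sqrt{}}=\arg\min_{f\in\mathbb{R}^n}\{\|Y-f\|_n+\lambda_0\|Df\|_1\}$, $\lambda_0>0$. Active sets: $[m]=\{1,\dots,m\}$; $d_i'$ is the $i$-th row of $D$. For $S\subseteq[m]$, $-S=[m]\setminus S$, $s=|S|$, and $D_S$, $D_{-S}$ are the submatrices of $D$ with rows indexed by $S$, $-S$. Put $S(f)=\{j\in[m]: d_j'f\neq0\}$ and $\mathcal{S}(D)=\{S\subseteq[m]:\exists f\in\mathbb{R}^n,\ S=S(f)\}$. $r_S=\dim \mathcal{N}(D_{-S})$, the dimension of the nullspace of $D_{-S}$. Scaling factor and weights: let $D_{-S}^+\in\mathbb{R}^{n\times(m-s)}$ be the Moore–Penrose pseudoinverse of $D_{-S}$, with columns $d_1^+,\dots,d_{m-s}^+$; for $i\in-S$ let $i^*(i)=\sum_{j=1}^i 1_{\{j\in -S\}}$ be the row index in $D_{-S}$ of the $i$-th row of $D$. Define $\omega_i=\|d^+_{i^*(i)}\|_n$ for $i\in-S$, $\omega_i=0$ for $i\in S$, $\gamma=\max_{i\in-S}\omega_i$, $w_i=1-\omega_i/\gamma$ for $i\in[m]$, and $W=\mathrm{diag}(\{w_i\}_{i\in[m]})$,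 $W_{-S}=\mathrm{diag}(\{w_i\}_{i\in-S})$. Weighted weak compatibility constant: $\kappa^2(S,W)=r_S\min\{\|f\|_n^2: f\in\mathbb{R}^n,\ \|D_Sf\|_1-\|W_{-S}D_{-S}f\|_1=1\}$, and $\kappa(S,W)$ is its nonnegative square root. *)

(* Defs.v *)
From HB Require Import structures.
From mathcomp Require Import all_boot all_order all_algebra.
From mathcomp Require Import all_classical all_reals all_analysis.

Set Implicit Arguments.
Unset Strict Implicit.
Unset Printing Implicit Defensive.

Import Order.TTheory GRing.Theory Num.Theory.

Local Open Scope classical_set_scope.
Local Open Scope ring_scope.

Section Norms.
Context {R : realType}.

Definition normn (n : nat) (f : 'cV[R]_n) : R :=
  Num.sqrt (\sum_i f i 0 ^+ 2 / n%:R).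

Definition norm1 (n : nat) (v : 'cV[R]_n) : R := \sum_i `|v i 0|.

End Norms.

Section PseudoInverse.
Context {R : realType}.

Definition penrose (m n : nat) (A : 'M[R]_(m, n)) (X : 'M[R]_(n, m)) : Prop :=
  [/\ A *m X *m A = A, X *m A *m X = X,
      (A *m X)^T = A *m X & (X *m A)^T = X *m A].

(* The matrix determined by the Penrose equations; [pinvP] and
   [penrose_unique] give existence and uniqueness. MathComp's [pinvmx] only
   satisfies part of these equations. *)
Definition pinv (m n : nat) (A : 'M[R]_(m, n)) : 'M[R]_(n, m) :=
  xget 0 [set X | penrose A X].

Lemma penrose_unique (m n : nat) (A : 'M[R]_(m, n)) (X Y : 'M[R]_(n, m)) :
  penrose A X -> penrose A Y -> X = Y.
Proof.
move=> [X1 X2 X3 X4] [Y1 Y2 Y3 Y4].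
have AXY : A *m X = A *m Y.
  by rewrite -X3 -{1}Y1 -mulmxA trmx_mul X3 Y3 mulmxA X1.
have XAY : X *m A = Y *m A.
  by rewrite -X4 -{1}Y1 -mulmxA mulmxA trmx_mul X4 Y4 -!mulmxA (mulmxA A X) X1.
by rewrite -X2 XAY -mulmxA AXY mulmxA Y2.
Qed.

Lemma gram_unit (k p : nat) (B : 'M[R]_(k, p)) :
  row_free B -> B *m B^T \in unitmx.
Proof.
move=> fB; rewrite -row_free_unit -kermx_eq0; apply/rowV0P => v.
move=> /sub_kermxP; rewrite mulmxA => vBB.
have vB0 : v *m B = 0.
  have : (v *m B) *m (v *m B)^T = 0 by rewrite trmx_mul mulmxA vBB mul0mx.
  move: (v *m B) => u /matrixP /(_ 0 0); rewrite !mxE => /eqP.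
  under eq_bigr do rewrite mxE -expr2.
  rewrite psumr_eq0 => [/allP h|i _]; last exact: sqr_ge0.
  apply/rowP => j; rewrite [RHS]mxE; apply/eqP.
  by have := h j (mem_index_enum _); rewrite sqrf_eq0.
by apply: (row_free_inj fB); rewrite /= mul0mx.
Qed.

Lemma penrose_full_rank (m n k : nat) (C : 'M[R]_(m, k)) (B : 'M[R]_(k, n)) :
  row_full C -> row_free B ->
  penrose (C *m B)
    (B^T *m invmx (B *m B^T) *m invmx (C^T *m C) *m C^T).
Proof.
move=> fC fB; have uB := gram_unit fB.
have uC : C^T *m C \in unitmx.
  by rewrite -{2}(trmxK C); apply: gram_unit; rewrite /row_free mxrank_tr.
set U := invmx (B *m B^T); set V := invmx (C^T *m C).
have UT : U^T = U by rewrite trmx_inv trmx_mul trmxK.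
have VT : V^T = V by rewrite trmx_inv trmx_mul trmxK.
set X := _ *m C^T.
have AX : C *m B *m X = C *m V *m C^T.
  by rewrite /X -!mulmxA (mulmxA B) (mulmxA (B *m _) U) mulmxV // mul1mx.
have XA : X *m (C *m B) = B^T *m U *m B.
  by rewrite /X -!mulmxA (mulmxA C^T) (mulmxA V) mulVmx // mul1mx.
split.
- by rewrite AX -!mulmxA (mulmxA C^T) (mulmxA V) mulVmx // mul1mx.
- by rewrite XA /X -!mulmxA (mulmxA B) (mulmxA (B *m _) U) mulmxV // mul1mx.
- by rewrite AX !trmx_mul trmxK VT mulmxA.
- by rewrite XA !trmx_mul trmxK UT mulmxA.
Qed.

Lemma pinvP (m n : nat) (A : 'M[R]_(m, n)) : penrose A (pinv A).
Proof.
suff : exists X, penrose A X by exact: (@xgetPex _ 0 [set X | penrose A X]).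
rewrite -(mulmx_base A); eexists; apply: penrose_full_rank.
  exact: col_base_full.
exact: row_base_free.
Qed.

End PseudoInverse.

Section AnalysisOperator.
Context {R : realType} {m n : nat}.
Implicit Types (D : 'M[R]_(m, n)) (S : {set 'I_m}).

(* [enum_val] lists the elements of a set of ordinals in increasing order. *)
Definition rows_of S D : 'M[R]_(#|S|, n) := rowsub (@enum_val _ (mem S)) D.

Definition active D (f : 'cV[R]_n) : {set 'I_m} :=
  [set j | row j D *m f != 0]%SET.

Definition active_sets D : set {set 'I_m} :=
  [set S | exists f : 'cV[R]_n, S = active D f].

(* kermx acts on row vectors: x^T *m (D_{-S})^T = 0 iff D_{-S} *m x = 0. *)
Definition nulldim D S : nat := \rank (kermx (rows_of (~: S)%SET D)^T).

(* The position of i in the enumeration of -S plays the role of i^*(i). *)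
Definition omega D S (i : 'I_m) : R :=
  if [pick j : 'I_#|(~: S)%SET| | enum_val j == i] is Some j
  then normn (col j (pinv (rows_of (~: S)%SET D))) else 0.

Definition gamma D S : R := \big[Num.max/0]_(i in (~: S)%SET) omega D S i.

Definition weights D S : 'M[R]_m :=
  diag_mx (\row_i (1 - omega D S i / gamma D S)).

Definition diag_block S (W : 'M[R]_m) : 'M[R]_#|S| :=
  mxsub (@enum_val _ (mem S)) (@enum_val _ (mem S)) W.

Definition kappa_feasible D S (W : 'M[R]_m) : set 'cV[R]_n :=
  [set f | norm1 (rows_of S D *m f)
           - norm1 (diag_block (~: S)%SET W *m rows_of (~: S)%SET D *m f) = 1].

(* Extended-real valued: the infimum is +oo when the constraint cannot be met
   (for instance when S is empty), and it is a minimum otherwise. *)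
Definition kappa2 D S (W : 'M[R]_m) : \bar R :=
  ((nulldim D S)%:R%:E *
   ereal_inf [set (normn f ^+ 2)%:E | f in kappa_feasible D S W])%E.

Definition kappa D S (W : 'M[R]_m) : \bar R := sqrte (kappa2 D S W).

Definition sqrt_analysis_objective D (lambda0 : R) (Y f : 'cV[R]_n) : R :=
  normn (Y - f) + lambda0 * norm1 (D *m f).

Definition is_sqrt_analysis D (lambda0 : R) (Y fhat : 'cV[R]_n) : Prop :=
  forall f, sqrt_analysis_objective D lambda0 Y fhat
            <= sqrt_analysis_objective D lambda0 Y f.

Lemma omega_enum_val D S (j : 'I_#|(~: S)%SET|) :
  omega D S (enum_val j) = normn (col j (pinv (rows_of (~: S)%SET D))).
Proof.
rewrite /omega; case: pickP => [k /eqP/enum_val_inj->//|/(_ j)].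
by rewrite eqxx.
Qed.

Lemma omega_in D S (i : 'I_m) : i \in S -> omega D S i = 0.
Proof.
rewrite /omega => iS; case: pickP => // j /eqP ji.
by have := enum_valP j; rewrite ji inE iS.
Qed.

End AnalysisOperator.

Section Probability.
Context {R : realType} {d : measure_display} {T : measurableType d}.

Definition mutually_independent (P : probability T R) (n : nat)
    (X : 'I_n -> {RV P >-> R}) : Prop :=
  forall (J : {set 'I_n}) (A : 'I_n -> set R),
    (forall i, measurable (A i)) ->
    P (\bigcap_(i in [set` J]) (X i @^-1` A i)) =
    (\prod_(i in J) P (X i @^-1` A i))%E.

(* The law N_n(0, sigma^2 I_n): independent N(0, sigma^2) coordinates. *)
Definition gaussian_noise (P : probability T R) (n : nat) (sigma : R)
    (eps : 'I_n -> {RV P >-> R}) : Prop :=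
  mutually_independent eps /\
  forall i (A : set R), measurable A ->
    distribution P (eps i) A = normal_prob 0 sigma A.

(* The event E is not assumed measurable; for measurable E this is
   p <= P E. *)
Definition holds_with_prob_ge (P : probability T R) (p : R) (E : set T) :
  Prop :=
  exists A : set T, [/\ measurable A, A `<=` E & (p%:E <= P A)%E].

End Probability.

(* Main.v *)
Require Import Defs.
From HB Require Import structures.
From mathcomp Require Import all_boot all_order all_algebra.
From mathcomp Require Import all_classical all_reals all_analysis.
From mathcomp Require Import measurable_realfun.
From mathcomp Require Import ring lra.

(** Write [A] for the rows of [D] outside [S], [e] for the noise and [Pi] for the
orthogonal projection onto the null space of [A].  The estimator minimizes a
convex function, so the derivative of the objective from [fhat] towards any [f]
is nonnegative ([sqrt_analysis_stationarity]):
<Y - fhat, f - fhat>_n <= |Y - fhat|_n lambda0 (|D f|_1 - |D fhat|_1).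
What remains is to dominate the noise <e, h>_n, [h := fhat - f], by the penalty.

The noise splits as <e, h> = <Pi e, h> + <e, A^+ A h>.  The first term is at most
|Pi e| |h|, and |Pi e|^2 / sigma^2 is a chi-square variable with at most [r]
degrees of freedom ([gaussian_projection_event]).  The second term has to be paid for by
the part of the penalty which the weights leave unused, the sum of
(1 - w_i) |(A h)_i| over the rows of [A]; this fixes the size of [lambda0].
A union bound over the rows of [A] would cost the logarithm of their number,
whereas [lambda0] only contains the logarithm of their rank [n - r], and the
rows may be far more numerous.  The rank suffices
([gaussian_weighted_l1]) because the column space of a matrix of rank [k]
carries weights [nu_i] of total mass at most 1 such that
|y_i| <= k nu_i |y|_1 for all its vectors [y] ([leverage_weights]).  Hence
|y_i| / |y|_1 is a probability vector dominated by [k nu], and Jensen's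
inequality for the exponential bounds all [y] at once by the single random
variable k sum_i nu_i (exp (s X_i) + exp (- s X_i)), whose mean is at most [2 k]
times that of exp (s X) for one Gaussian [X].

This noise bound is proportional to [sigma], the penalty to the residual norm
|Y - fhat|_n.  The two are comparable since the residual norm lies between
(1 - eta) sigma and 2 sigma.  The upper bound compares the objective at [fhat]
and at [f0].  For the lower bound, [residual_lower] shows that the residual
norm is at least (1 - eta / 2) |e|_n: otherwise [fhat - f0] would be large,
which the stationarity inequality at [f0] forbids when |D f0|_1 is small.
Moreover (1 - eta / 2) |e|_n >= (1 - eta) sigma because |e|_n^2 is at least
sigma^2 (1 - sqrt (8 a / n)) with high probability and sqrt (8 a / n) < eta.

On the event where these bounds hold, stationarity at [f], the compatibility
constant and completing a square give the claim ([oracle_inequality]).  The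
event fails with probability at most 3 exp (- a) + exp (- t).  The tails come
from Chernoff bounds; the moment generating function of |Pi e|^2 is computed
without rotating the Gaussian vector, by writing the exponential of each square
as a Gaussian average of exponentials of linear forms
([gaussian_expR_proj]). *)

Set Implicit Arguments.
Unset Strict Implicit.
Unset Printing Implicit Defensive.

Import Order.TTheory GRing.Theory Num.Theory.
Import numFieldNormedType.Exports HBNNSimple.

Local Open Scope classical_set_scope.
Local Open Scope ring_scope.

(** * Integrals of product and Gaussian form *)

Lemma integral_indic_preimage (R : realType) (d : measure_display)
    (T : measurableType d) (mu : {measure set T -> \bar R}) (Y : T -> R)
    (A : set R) :
  measurable_fun setT Y -> measurable A ->
  (\int[mu]_y (\1_A (Y y))%:E = mu (Y @^-1` A))%E.
Proof.
move=> mY mA; rewrite -[in RHS](setIT (Y @^-1` A)) -integral_indic//.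
by rewrite -[X in measurable X]setTI; exact: mY.
Qed.

(** An identity between a weighted and an unweighted law extends from indicators
to nonnegative functions by approximation with simple functions.  It is used
once for densities ([w] a density, [X] the identity) and once for independence
([w] the product of the other factors). *)
Lemma ge0_integral_transfer (R : realType) (d1 d2 : measure_display)
    (T1 : measurableType d1) (T2 : measurableType d2)
    (mu : {measure set T1 -> \bar R}) (nu : {measure set T2 -> \bar R})
    (w : T1 -> R) (X : T1 -> R) (Y : T2 -> R) (C : R) (phi : R -> R) :
  measurable_fun setT w -> (forall x, 0 <= w x) ->
  measurable_fun setT X -> measurable_fun setT Y -> 0 <= C ->
  (forall A : set R, measurable A ->
    (\int[mu]_x (w x * \1_A (X x))%:E = C%:E * nu (Y @^-1` A))%E) ->
  measurable_fun setT phi -> (forall x, 0 <= phi x) ->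
  (\int[mu]_x (w x * phi (X x))%:E = C%:E * \int[nu]_y (phi (Y y))%:E)%E.
Proof.
move=> mw w0 mX mY C0 H mphi phi0.
have mphi' : measurable_fun setT (fun y : R => (phi y)%:E).
  exact/measurable_EFinP.
pose h := nnsfun_approx measurableT mphi'.
have hcvg x : EFin \o h ^~ x @ \oo --> (phi x)%:E.
  by apply: (@cvg_nnsfun_approx _ _ _ _ measurableT _ mphi') => // y _; rewrite lee_fin.
have hnd x a b : (a <= b)%N -> h a x <= h b x.
  by move=> ab; exact/lefP/nd_nnsfun_approx.
have mh n : measurable_fun setT (h n) by exact/measurable_funP.
have -> : (\int[nu]_y (phi (Y y))%:E =
    limn (fun n => \int[nu]_y (h n (Y y))%:E))%E.
  rewrite -monotone_convergence//.
  - by apply: eq_integral => y _; apply/esym/cvg_lim => //; exact: hcvg.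
  - by move=> n; apply/measurable_EFinP; exact: measurableT_comp.
  - by move=> n x _; rewrite lee_fin.
  - by move=> x _ a b ab; rewrite lee_fin; exact: hnd.
have -> : (\int[mu]_x (w x * phi (X x))%:E =
    limn (fun n => \int[mu]_x (w x * h n (X x))%:E))%E.
  rewrite -monotone_convergence//.
  - apply: eq_integral => y _; apply/esym/cvg_lim => //.
    under eq_fun do rewrite EFinM.
    by rewrite EFinM; apply: cvgeZl => //; exact: hcvg.
  - move=> n; apply/measurable_EFinP; apply: measurable_funM => //.
    exact: measurableT_comp.
  - by move=> n x _; rewrite lee_fin mulr_ge0.
  - by move=> x _ a b ab; rewrite lee_fin ler_wpM2l//; exact: hnd.
rewrite -limeMl//; last first.
  apply: ereal_nondecreasing_is_cvgn => a b ab; apply: ge0_le_integral => //.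
  - by move=> x _; rewrite lee_fin.
  - by apply/measurable_EFinP; exact: measurableT_comp.
  - by apply/measurable_EFinP; exact: measurableT_comp.
  - by move=> x _; rewrite lee_fin; exact: hnd.
congr (limn _); apply/funext => n.
have hE x : (h n x)%:E = (\sum_(y \in range (h n)) (y * \1_(h n @^-1` [set y]) x)%:E)%E.
  by rewrite fsumEFin// -fimfunE.
under [in LHS]eq_integral => x _.
  rewrite EFinM hE ge0_mule_fsumr; last by move=> y; exact: nnfun_muleindic_ge0.
  over.
under [in RHS]eq_integral do rewrite hE.
rewrite ge0_integral_fsum//; last 2 first.
- move=> y; apply/emeasurable_funM; first exact/measurable_EFinP.
  apply/measurable_EFinP; apply: measurable_funM => //.
  by apply: measurableT_comp.
- by move=> y x _; apply: mule_ge0; [rewrite lee_fin|exact: nnfun_muleindic_ge0].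
rewrite ge0_integral_fsum//; last 2 first.
- move=> y; apply/measurable_EFinP; apply: measurable_funM => //.
  by apply: measurableT_comp.
- by move=> y x _; exact: nnfun_muleindic_ge0.
rewrite ge0_mule_fsumr; last first.
  by move=> y; apply: integral_ge0 => x _; exact: nnfun_muleindic_ge0.
apply: eq_fsbigr => r; rewrite inE => -[z _ rz].
have r0 : 0 <= r by rewrite -rz.
have mA : measurable (h n @^-1` [set r]) by [].
under eq_integral do rewrite -EFinM mulrCA EFinM.
rewrite ge0_integralZl//; last 2 first.
- apply/measurable_EFinP; apply: measurable_funM => //.
  by apply: measurableT_comp.
- by move=> x _; rewrite lee_fin mulr_ge0.
rewrite H//.
under [in RHS]eq_integral do rewrite EFinM.
rewrite ge0_integralZl//; last first.
  by apply/measurable_EFinP; apply: measurableT_comp.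
rewrite integral_indic_preimage//.
by rewrite !muleA (muleC r%:E).
Qed.

Lemma ge0_integral_scale (R : realType) (d : measure_display)
    (T : measurableType d) (mu : {measure set T -> \bar R}) (k : R) (f : T -> R) :
  0 <= k -> measurable_fun setT f -> (forall x, 0 <= f x) ->
  (\int[mu]_x (k * f x)%:E = k%:E * \int[mu]_x (f x)%:E)%E.
Proof.
move=> k0 mf f0; under eq_integral do rewrite EFinM.
rewrite ge0_integralZl//; first exact/measurable_EFinP.
by move=> x _; rewrite lee_fin.
Qed.

Lemma integral_normal_law (R : realType) (d : measure_display)
    (T : measurableType d) (mu : {measure set T -> \bar R}) (Y : T -> R)
    (s : R) (phi : R -> R) :
  measurable_fun setT Y ->
  (forall A : set R, measurable A -> mu (Y @^-1` A) = normal_prob 0 s A) ->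
  measurable_fun setT phi -> (forall x, 0 <= phi x) ->
  (\int[mu]_x (phi (Y x))%:E =
   \int[lebesgue_measure]_x (normal_pdf 0 s x * phi x)%:E)%E.
Proof.
move=> mY HY mphi phi0.
rewrite (@ge0_integral_transfer R _ _ (measurableTypeR R) T lebesgue_measure mu
  (normal_pdf 0 s) id Y 1 phi) ?mul1e//.
- exact: measurable_normal_pdf.
- by move=> x; exact: normal_pdf_ge0.
- move=> A mA; rewrite mul1e HY// /normal_prob [RHS]integral_mkcond.
  apply: eq_integral => x _; rewrite patchE indicE.
  by case: (x \in A); rewrite ?mulr1 ?mulr0.
Qed.

(** Completing the square turns the integrand into a multiple of the density of
a shifted normal law. *)
Lemma integral_normal_expR_linear (R : realType) (s a : R) : 0 < s ->
  (\int[lebesgue_measure]_x (normal_pdf 0 s x * expR (a * x))%:E =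
   (expR (a ^+ 2 * s ^+ 2 / 2))%:E)%E.
Proof.
move=> s0; have sn0 : s != 0 by rewrite gt_eqF.
have E x : normal_pdf 0 s x * expR (a * x) =
    expR (a ^+ 2 * s ^+ 2 / 2) * normal_pdf (a * s ^+ 2) s x.
  rewrite !normal_pdfE// /normal_fun mulrCA -!mulrA -!expRD; congr (_ * expR _).
  by field; rewrite sn0.
under eq_integral do rewrite E.
rewrite ge0_integral_scale ?integral_normal_pdf ?mule1//.
- exact: measurable_normal_pdf.
- by move=> x; exact: normal_pdf_ge0.
Qed.

(** The integrand is a multiple of the density of a centered normal law with
standard deviation [s / sqrt (1 - 2 b s^2)]. *)
Lemma integral_normal_expR_sqr (R : realType) (s b : R) :
  0 < s -> 0 < 1 - 2 * b * s ^+ 2 ->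
  (\int[lebesgue_measure]_x (normal_pdf 0 s x * expR (b * x ^+ 2))%:E =
   ((Num.sqrt (1 - 2 * b * s ^+ 2))^-1)%:E)%E.
Proof.
move=> s0 q0; set q := 1 - _ in q0 *.
have sq0 : 0 < Num.sqrt q by rewrite sqrtr_gt0.
have sn0 : s != 0 by rewrite gt_eqF.
have sqn0 : Num.sqrt q != 0 by rewrite gt_eqF.
have tn0 : s / Num.sqrt q != 0 by rewrite mulf_neq0// invr_eq0.
have E x : normal_pdf 0 s x * expR (b * x ^+ 2) =
    (Num.sqrt q)^-1 * normal_pdf 0 (s / Num.sqrt q) x.
  rewrite !normal_pdfE// /normal_fun -mulrA -expRD mulrA; congr (_ * expR _).
    rewrite /normal_peak expr_div_n sqr_sqrtr ?ltW// -invfM; congr (_^-1).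
    rewrite -sqrtrM ?ltW//.
    by congr Num.sqrt; field; rewrite gt_eqF.
  rewrite expr_div_n sqr_sqrtr ?ltW// subr0.
  by rewrite /q; field; rewrite sn0 gt_eqF.
under eq_integral do rewrite E.
rewrite ge0_integral_scale ?integral_normal_pdf ?mule1//.
- exact: measurable_normal_pdf.
- by move=> x; exact: normal_pdf_ge0.
Qed.

(** Independence is the case where all the factors are indicators; these are
replaced one at a time by general functions through [ge0_integral_transfer]. *)
Lemma mutually_independent_prod (R : realType) (d : measure_display)
    (T : measurableType d) (P : probability T R) (n : nat)
    (X : 'I_n -> {RV P >-> R}) (f : 'I_n -> R -> R) (c : 'I_n -> R) :
  mutually_independent X ->
  (forall i, measurable_fun setT (f i)) -> (forall i x, 0 <= f i x) ->
  (forall i, (\int[P]_x (f i (X i x))%:E = (c i)%:E)%E) ->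
  (\int[P]_x (\prod_i f i (X i x))%:E = (\prod_i c i)%:E)%E.
Proof.
move=> indep.
(* Induction on the number k of factors that are not indicators. *)
suff H k : forall (f : 'I_n -> R -> R) (c : 'I_n -> R),
    (forall i : 'I_n, (k <= i)%N -> exists2 A, measurable A & f i = \1_A) ->
    (forall i, measurable_fun setT (f i)) -> (forall i x, 0 <= f i x) ->
    (forall i, (\int[P]_x (f i (X i x))%:E = (c i)%:E)%E) ->
    (\int[P]_x (\prod_i f i (X i x))%:E = (\prod_i c i)%:E)%E.
  by apply: (H n) => i; rewrite leqNgt ltn_ord.
elim: k => [|k IH] {}f {}c find mf f0 Ef.
  have {find} [A HA] : {A : 'I_n -> set R &
      forall i, measurable (A i) /\ f i = \1_(A i)}.
    apply: (@choice _ _ (fun i A => measurable A /\ f i = \1_A)) => i.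
    by have [A mA fA] := find i isT; exists A.
  have mA i : measurable (A i) by case: (HA i).
  have mXA i : measurable (X i @^-1` A i).
    by rewrite -[X in measurable X]setTI; exact: measurable_funP.
  have -> : (fun x => (\prod_i f i (X i x))%:E : \bar R) =
      (fun x => (\1_(\bigcap_(i in [set` [set: 'I_n]%SET]) (X i @^-1` A i)) x)%:E).
    apply/funext => x; congr (_%:E); rewrite indicE.
    have [h|h] := boolP (x \in _).
      move: h; rewrite inE => h; rewrite big1// => i _.
      rewrite (HA i).2 indicE mem_set//.
      by apply: h; rewrite /= inE.
    have /existsP [i hi] : [exists i, X i x \notin A i].
      apply: contraNT h => /existsPn h; rewrite inE => i _ /=.
      by have := h i; rewrite negbK inE.
    by rewrite (bigD1 i)//= (HA i).2 indicE (negbTE hi) mul0r.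
  rewrite integral_indic//; last by apply: fin_bigcap_measurable.
  rewrite setIT; apply: (etrans (indep [set: _]%SET A mA)).
  rewrite (eq_bigr (fun i => (c i)%:E)); last first.
    move=> i _; rewrite -Ef (HA i).2.
    by apply/esym/integral_indic_preimage; first exact: measurable_funP.
  rewrite prodEFin.
  by apply: congr1; apply: eq_bigl => i; rewrite inE.
have [kn|nk] := ltnP k n; last first.
  by apply: IH => // i ki; have := leq_trans nk ki; rewrite leqNgt ltn_ord.
pose k0 := Ordinal kn.
pose w x := \prod_(i | i != k0) f i (X i x).
have E x : \prod_i f i (X i x) = w x * f k0 (X k0 x).
  by rewrite (bigD1 k0)//= mulrC.
under eq_integral do rewrite E.
have c0 i : 0 <= c i.
  by rewrite -lee_fin -Ef; apply: integral_ge0 => x _; rewrite lee_fin.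
rewrite (@ge0_integral_transfer R _ _ T T P P w (X k0) (X k0)
  (\prod_(i | i != k0) c i) (f k0))//.
- by rewrite Ef -EFinM; congr (_%:E); rewrite [RHS](bigD1 k0)//= mulrC.
- rewrite (_ : w = fun x =>
      \prod_(i <- [seq i <- index_enum 'I_n | i != k0]) f i (X i x)).
    by apply: measurable_prod => i _; apply: measurableT_comp.
  by apply/funext => x; rewrite big_filter.
- by move=> x; apply: prodr_ge0.
- by apply: prodr_ge0.
move=> A mA.
have PA : P (X k0 @^-1` A) = (fine (P (X k0 @^-1` A)))%:E.
  by rewrite fineK// fin_num_measure// -[X in measurable X]setTI; exact: measurable_funP.
(* Replacing the factor [f k0] by an indicator puts us in the case of [k] factors. *)
pose f' i := if i == k0 then \1_A else f i.
pose c' i := if i == k0 then fine (P (X k0 @^-1` A)) else c i.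
have W x : w x * \1_A (X k0 x) = \prod_i f' i (X i x).
  rewrite (bigD1 k0)//= mulrC /f' eqxx; congr (_ * _).
  by apply: eq_bigr => i /negbTE ->.
under eq_integral do rewrite W.
rewrite (IH f' c').
- rewrite [X in (_ * X)%E]PA -EFinM; congr (_%:E).
  rewrite (bigD1 k0)//= mulrC /c' eqxx; congr (_ * _).
  by apply: eq_bigr => i /negbTE ->.
- move=> i ki; rewrite /f'; case: eqP => [_|/eqP ik]; first by exists A.
  apply: find; rewrite ltn_neqAle ki andbT; apply: contraNneq ik => ik.
  by apply/eqP/val_inj.
- by move=> i; rewrite /f'; case: eqP.
- by move=> i x; rewrite /f'; case: eqP.
- move=> i; rewrite /f' /c'; case: eqP => [->|//].
  apply: etrans PA.
  by apply: integral_indic_preimage; first exact: measurable_funP.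
Qed.

(** * Moment generating functions of a Gaussian vector *)

Definition dot (R : realType) (n : nat) (u v : 'cV[R]_n) : R :=
  \sum_i u i 0 * v i 0.

Lemma dotC (R : realType) (n : nat) (u v : 'cV[R]_n) : dot u v = dot v u.
Proof. by apply: eq_bigr => i _; rewrite mulrC. Qed.

Lemma dotDl (R : realType) (n : nat) (u v w : 'cV[R]_n) :
  dot (u + v) w = dot u w + dot v w.
Proof. by rewrite -big_split; apply: eq_bigr => i _; rewrite !mxE mulrDl. Qed.

Lemma dotZl (R : realType) (n : nat) (a : R) (u w : 'cV[R]_n) :
  dot (a *: u) w = a * dot u w.
Proof. by rewrite mulr_sumr; apply: eq_bigr => i _; rewrite !mxE mulrA. Qed.

Lemma dotNl (R : realType) (n : nat) (u w : 'cV[R]_n) : dot (- u) w = - dot u w.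
Proof. by rewrite -scaleN1r dotZl mulN1r. Qed.

Lemma dotBl (R : realType) (n : nat) (u v w : 'cV[R]_n) :
  dot (u - v) w = dot u w - dot v w.
Proof. by rewrite dotDl dotNl. Qed.

Lemma dotDr (R : realType) (n : nat) (u v w : 'cV[R]_n) :
  dot w (u + v) = dot w u + dot w v.
Proof. by rewrite dotC dotDl !(dotC _ w). Qed.

Lemma dotZr (R : realType) (n : nat) (a : R) (u w : 'cV[R]_n) :
  dot w (a *: u) = a * dot w u.
Proof. by rewrite dotC dotZl dotC. Qed.

Lemma dotNr (R : realType) (n : nat) (u w : 'cV[R]_n) : dot w (- u) = - dot w u.
Proof. by rewrite dotC dotNl dotC. Qed.

Lemma dotBr (R : realType) (n : nat) (u v w : 'cV[R]_n) :
  dot w (u - v) = dot w u - dot w v.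
Proof. by rewrite dotC dotBl !(dotC _ w). Qed.

Lemma dot_ge0 (R : realType) (n : nat) (u : 'cV[R]_n) : 0 <= dot u u.
Proof. by apply: sumr_ge0 => i _; rewrite -expr2 sqr_ge0. Qed.

Lemma dot_eq0 (R : realType) (n : nat) (u : 'cV[R]_n) : (dot u u == 0) = (u == 0).
Proof.
apply/eqP/eqP => [|->]; last by rewrite /dot big1// => i _; rewrite mxE mul0r.
move=> /eqP; rewrite psumr_eq0 => [/allP h|i _]; last by rewrite -expr2 sqr_ge0.
apply/colP => i; rewrite [RHS]mxE; apply/eqP.
by have := h i (mem_index_enum _); rewrite -expr2 sqrf_eq0.
Qed.

Lemma dot_mulmx (R : realType) (m n : nat) (A : 'M[R]_(m, n)) (u : 'cV[R]_m)
    (v : 'cV[R]_n) : dot u (A *m v) = dot (A^T *m u) v.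
Proof.
have dotE k (x y : 'cV[R]_k) : dot x y = (x^T *m y) 0 0.
  by rewrite mxE; apply: eq_bigr => i _; rewrite mxE.
by rewrite !dotE trmx_mul trmxK mulmxA.
Qed.

Lemma measurable_dot (R : realType) (d : measure_display) (T : measurableType d)
    (P : probability T R) (n : nat) (eps : 'I_n -> {RV P >-> R}) (b : 'cV[R]_n) :
  measurable_fun setT (fun x => dot b (\col_i eps i x)).
Proof.
rewrite /dot; apply: measurable_sum => i.
under eq_fun do rewrite mxE.
by apply: measurable_funM => //; exact: measurable_funP.
Qed.

Lemma gaussian_expR_dot (R : realType) (d : measure_display) (T : measurableType d)
    (P : probability T R) (n : nat) (sigma : R) (eps : 'I_n -> {RV P >-> R})
    (b : 'cV[R]_n) :
  0 < sigma -> gaussian_noise sigma eps ->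
  (\int[P]_x (expR (dot b (\col_i eps i x)))%:E =
   (expR (sigma ^+ 2 * dot b b / 2))%:E)%E.
Proof.
move=> s0 [ind law].
have E x : expR (dot b (\col_i eps i x)) = \prod_i expR (b i 0 * eps i x).
  by rewrite -expR_sum; congr expR; apply: eq_bigr => i _; rewrite mxE.
under eq_integral do rewrite E.
rewrite (mutually_independent_prod (P := P) (X := eps)
  (f := fun i y => expR (b i 0 * y))
  (c := fun i => expR (b i 0 ^+ 2 * sigma ^+ 2 / 2)) ind).
- rewrite -expR_sum; congr ((expR _)%:E).
  by rewrite /dot mulr_sumr mulr_suml; apply: eq_bigr => i _; rewrite -expr2; ring.
- move=> i; apply: measurableT_comp; first exact: measurable_expR.
  exact: measurable_funM.
- by move=> i x; exact: expR_ge0.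
- move=> i; rewrite -(integral_normal_expR_linear (b i 0) s0).
  apply: (integral_normal_law (phi := fun y => expR (b i 0 * y))).
  + exact: measurable_funP.
  + by move=> A mA; exact: law.
  + apply: measurableT_comp; first exact: measurable_expR.
    exact: measurable_funM.
  + by move=> x; exact: expR_ge0.
Qed.

Lemma gaussian_expR_sqnorm (R : realType) (d : measure_display) (T : measurableType d)
    (P : probability T R) (n : nat) (sigma : R) (eps : 'I_n -> {RV P >-> R})
    (s : R) :
  0 < sigma -> gaussian_noise sigma eps -> 0 < 1 - 2 * s * sigma ^+ 2 ->
  (\int[P]_x (expR (s * dot (\col_i eps i x) (\col_i eps i x)))%:E =
   ((Num.sqrt (1 - 2 * s * sigma ^+ 2))^-1 ^+ n)%:E)%E.
Proof.
move=> s0 [ind law] q0.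
have E x : expR (s * dot (\col_i eps i x) (\col_i eps i x)) =
    \prod_i expR (s * (eps i x) ^+ 2).
  by rewrite -expR_sum /dot mulr_sumr; congr expR; apply: eq_bigr => i _; rewrite mxE.
under eq_integral do rewrite E.
rewrite (mutually_independent_prod (P := P) (X := eps)
  (f := fun i y => expR (s * y ^+ 2))
  (c := fun i => (Num.sqrt (1 - 2 * s * sigma ^+ 2))^-1) ind).
- by rewrite prodr_const card_ord.
- move=> i; apply: measurableT_comp; first exact: measurable_expR.
  by apply: measurable_funM => //; apply: measurable_funX.
- by move=> i x; exact: expR_ge0.
- move=> i; rewrite -(integral_normal_expR_sqr s0 q0).
  apply: (integral_normal_law (phi := fun y => expR (s * y ^+ 2))).
  + exact: measurable_funP.
  + by move=> A mA; exact: law.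
  + apply: measurableT_comp; first exact: measurable_expR.
    by apply: measurable_funM => //; apply: measurable_funX.
  + by move=> x; exact: expR_ge0.
Qed.

Fixpoint orthonormal_seq (R : realType) (n : nat) (qs : seq 'cV[R]_n) : Prop :=
  if qs is q :: qs' then
    [/\ dot q q = 1, (forall p, p \in qs' -> dot p q = 0) & orthonormal_seq qs']
  else True.

(** For orthonormal [qs] the squares of the coordinates <q, e> have the moment
generating function of a chi-square variable.  With [c^2 = 2 s], the factor
exp (s <q, e>^2) is the average of exp (c g <q, e>) over a standard normal [g];
by Tonelli this replaces one square by the linear term [c g q], which is added
to [b].  The linear term [b] is in the statement to make this induction work. *)
Lemma gaussian_expR_proj (R : realType) (d : measure_display) (T : measurableType d)
    (P : probability T R) (n : nat) (sigma : R) (eps : 'I_n -> {RV P >-> R})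
    (s : R) (qs : seq 'cV[R]_n) (b : 'cV[R]_n) :
  0 < sigma -> gaussian_noise sigma eps ->
  0 <= s -> 0 < 1 - 2 * s * sigma ^+ 2 ->
  orthonormal_seq qs -> (forall q, q \in qs -> dot q b = 0) ->
  (\int[P]_x (expR (dot b (\col_i eps i x) +
     s * \sum_(q <- qs) dot q (\col_i eps i x) ^+ 2))%:E =
   (expR (sigma ^+ 2 * dot b b / 2) *
    (Num.sqrt (1 - 2 * s * sigma ^+ 2))^-1 ^+ size qs)%:E)%E.
Proof.
move=> s0 Heps sge0 q0.
have m_dot := measurable_dot eps.
elim: qs b => [|q qs IH] b.
  move=> _ _; rewrite expr0 mulr1 -(gaussian_expR_dot b s0 Heps).
  by apply: eq_integral => x _; rewrite big_nil mulr0 addr0.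
move=> [qq qp oqs] qb.
pose c := Num.sqrt (2 * s).
have c2 : c ^+ 2 = 2 * s by rewrite sqr_sqrtr// mulr_ge0.
pose e x := \col_i eps i x.
pose N : probability (measurableTypeR R) R := normal_prob 0 1.
have lawN (phi : R -> R) : measurable_fun setT phi -> (forall x, 0 <= phi x) ->
  (\int[N]_g (phi g)%:E = \int[lebesgue_measure]_g (normal_pdf 0 1 g * phi g)%:E)%E.
  by move=> mphi phi0; apply: (@integral_normal_law R _ (measurableTypeR R) N id 1 phi).
pose F (z : T * measurableTypeR R) : R :=
  dot b (e z.1) + c * z.2 * dot q (e z.1) + s * \sum_(p <- qs) dot p (e z.1) ^+ 2.
have mF : measurable_fun setT F.
  apply: measurable_funD; [apply: measurable_funD|].
  - by apply: (measurableT_comp (m_dot b)).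
  - apply: measurable_funM; first exact: measurable_funM.
    by apply: (measurableT_comp (m_dot q)).
  - apply: measurable_funM => //.
    apply: measurable_sum => p; apply: measurable_funX.
    by apply: (measurableT_comp (m_dot p)).
have mexpF : measurable_fun setT (fun z => (expR (F z))%:E).
  apply/measurable_EFinP; apply: measurableT_comp => //; exact: measurable_expR.
have E x : ((expR (dot b (e x) + s * \sum_(p <- q :: qs) dot p (e x) ^+ 2))%:E =
    \int[N]_g (expR (F (x, g)))%:E)%E.
  have EF g : expR (F (x, g)) =
     expR (dot b (e x) + s * \sum_(p <- qs) dot p (e x) ^+ 2) *
     expR (c * dot q (e x) * g).
    by rewrite -expRD; congr expR; rewrite /F /=; ring.
  under eq_integral do rewrite EF.
  rewrite ge0_integral_scale//; last first.
    apply: measurableT_comp; first exact: measurable_expR.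
    exact: measurable_funM.
  rewrite (lawN (fun g => expR (c * dot q (e x) * g))) //; last first.
    apply: measurableT_comp; first exact: measurable_expR.
    exact: measurable_funM.
  rewrite integral_normal_expR_linear// -EFinM -expRD; congr ((expR _)%:E).
  by rewrite big_cons exprMn c2 expr1n; field.
under eq_integral do rewrite E.
rewrite (fubini_tonelli (m1 := P) (m2 := N) (fun z => (expR (F z))%:E))//.
have E2 g : (\int[P]_x (expR (F (x, g)))%:E =
   (expR (sigma ^+ 2 * dot b b / 2) *
    (Num.sqrt (1 - 2 * s * sigma ^+ 2))^-1 ^+ size qs *
     expR (s * sigma ^+ 2 * g ^+ 2))%:E)%E.
  have := IH (b + (c * g) *: q) oqs.
  rewrite (_ : dot (b + _) _ = dot b b + 2 * s * g ^+ 2); last first.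
    rewrite dotDl !dotDr !dotZl !dotZr qq (dotC b q) (qb q (mem_head _ _)).
    by rewrite -c2; ring.
  have -> : expR (sigma ^+ 2 * (dot b b + 2 * s * g ^+ 2) / 2) =
     expR (sigma ^+ 2 * dot b b / 2) * expR (s * sigma ^+ 2 * g ^+ 2).
    by rewrite -expRD; congr expR; field.
  rewrite mulrAC => <-.
    by apply: eq_integral => x _; rewrite /F /= dotDl dotZl.
  move=> p pqs; rewrite dotDr dotZr qp// mulr0 addr0 qb//.
  by rewrite inE pqs orbT.
under eq_integral do rewrite E2.
rewrite ge0_integral_scale; last 3 first.
- by rewrite mulr_ge0 ?expR_ge0// exprn_ge0// invr_ge0 sqrtr_ge0.
- apply: measurableT_comp; first exact: measurable_expR.
  by apply: measurable_funM => //; apply: measurable_funX.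
- by move=> x; exact: expR_ge0.
rewrite (lawN (fun g => expR (s * sigma ^+ 2 * g ^+ 2))) //; last first.
  apply: measurableT_comp; first exact: measurable_expR.
  by apply: measurable_funM => //; apply: measurable_funX.
have q0' : 0 < 1 - 2 * (s * sigma ^+ 2) * 1 ^+ 2 by rewrite expr1n mulr1 mulrA.
rewrite integral_normal_expR_sqr// expr1n mulr1 -EFinM.
by rewrite [size (q :: qs)]/= [X in _ = (_ * X)%:E]exprSr !mulrA.
Qed.

(** * Leverage weights of a matrix *)

(** Cramer's rule: row [i] of [G] is expressed through the rows of [M], the
coefficients being determinants in which a row of [M] is replaced by row [i]. *)
Lemma cramer_row (R : realType) (k r : nat) (G : 'M[R]_(k, r)) (M : 'M[R]_r)
    (i : 'I_k) (g : 'cV[R]_r) :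
  \det M * (G *m g) i 0 =
  \sum_l \det (\matrix_(l', j) (if l' == l then G i j else M l' j)) * (M *m g) l 0.
Proof.
have -> : \det M * (G *m g) i 0 = ((row i G *m \adj M) *m (M *m g)) 0 0.
  rewrite -mulmxA (mulmxA (\adj M)) mul_adj_mx mul_scalar_mx -scalemxAr.
  by rewrite -row_mul !mxE.
rewrite mxE; apply: eq_bigr => l _; congr (_ * _).
rewrite (expand_det_row _ l) mxE; apply: eq_bigr => j _.
rewrite !mxE eqxx; congr (_ * _); rewrite /cofactor; congr (_ * \det _).
by apply/matrixP => a b; rewrite !mxE eq_sym (negbTE (neq_lift _ _)).
Qed.

(** Volume sampling: draw [\rank C] rows with probability proportional to the
absolute determinant of the chosen rows in a basis of the column space, and let
[\rank C * nu i] be the probability that row [i] is drawn.  By Cramer's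
rule, |det C_s| |y_i| is at most the sum over [l] of the absolute determinants
with the [l]-th chosen row replaced by [i], times |y_(s l)|; summing over all
choices [s] and exchanging the replaced row with [i] gives the bound. *)
Lemma leverage_weights (R : realType) (k n : nat) (C : 'M[R]_(k, n)) :
  exists nu : 'I_k -> R, [/\ forall i, 0 <= nu i, \sum_i nu i <= 1 &
    forall (h : 'cV[R]_n) i,
      `|(C *m h) i 0| <= (\rank C)%:R * nu i * \sum_j `|(C *m h) j 0|].
Proof.
pose r := \rank C; pose G : 'M[R]_(k, r) := col_base C.
pose D (s : {ffun 'I_r -> 'I_k}) := `|\det (rowsub s G)|.
pose T := \sum_s D s.
(* [b i / T] is the expected number of positions at which row [i] is drawn. *)
pose b i := \sum_(l < r) \sum_(s : {ffun 'I_r -> 'I_k} | s l == i) D s.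
have D0 s : 0 <= D s by exact: normr_ge0.
have T0 : 0 < T.
  have fG : row_full G by exact: col_base_full.
  rewrite /T (bigD1 (fullrankfun fG))//= ltr_pwDl//; last by apply: sumr_ge0.
  by rewrite normr_gt0 -unitfE -unitmxE fullrowsub_unit.
have b0 i : 0 <= b i by apply: sumr_ge0 => l _; apply: sumr_ge0.
have key (h : 'cV[R]_n) i : T * `|(C *m h) i 0| <= b i * \sum_j `|(C *m h) j 0|.
  pose g : 'cV[R]_r := row_base C *m h.
  have Cg : C *m h = G *m g by rewrite mulmxA mulmx_base.
  pose upd (s : {ffun 'I_r -> 'I_k}) l i := [ffun l' => if l' == l then i else s l'].
  have step s : D s * `|(C *m h) i 0| <=
      \sum_l D (upd s l i) * `|(C *m h) (s l) 0|.
    rewrite {1}/D -normrM Cg. rewrite cramer_row; apply: le_trans (ler_norm_sum _ _ _) _.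
    apply: ler_sum => l _; rewrite normrM /D.
    rewrite (_ : \matrix_(_, _) _ = rowsub (upd s l i) G); last first.
      by apply/matrixP => x y; rewrite !mxE ffunE; case: eqP.
    rewrite (_ : (rowsub s G *m g) l 0 = (G *m g) (s l) 0)//.
    by rewrite !mxE; apply: eq_bigr => j _; rewrite mxE.
  rewrite /T /b mulr_suml; apply: le_trans (ler_sum _ (fun s _ => step s)) _.
  rewrite exchange_big/= mulr_suml; apply: ler_sum => l _.
  rewrite big_distrlr/= pair_big_dep/=.
  rewrite (reindex_onto (fun s => (upd s l i, s l)) (fun p => upd p.1 l p.2))/=.
    rewrite le_eqVlt; apply/orP; left; apply/eqP; apply: eq_bigl => s.
    rewrite ffunE eqxx eqxx andbT /=; apply/esym/eqP/ffunP => l'.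
    by rewrite !ffunE; case: eqP => [->|].
  move=> [s j] /=; rewrite andbT => /eqP si; congr (_, _).
    by apply/ffunP => l'; rewrite !ffunE; case: eqP => [->|].
  by rewrite ffunE eqxx.
have sumb : \sum_i b i = r%:R * T.
  transitivity (\sum_(l < r) T); last by rewrite sumr_const card_ord mulr_natl.
  rewrite exchange_big/=; apply: eq_bigr => l _.
  by rewrite /T (partition_big (fun s : {ffun 'I_r -> 'I_k} => s l) predT).
have [r0|r0] := eqVneq r 0%N.
  exists (fun=> 0); split => //; first by rewrite big1.
  move=> h i; rewrite mulr0 mul0r.
  have := key h i; rewrite (_ : b i = 0) ?mul0r ?pmulr_rle0//.
  by apply: big1 => -[l lr] _; exfalso; move: lr; rewrite r0.
have rn0 : 0 < r%:R :> R by rewrite ltr0n lt0n.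
exists (fun i => b i / (r%:R * T)); split.
- by move=> i; rewrite divr_ge0// mulr_ge0// ltW.
- by rewrite -mulr_suml sumb divff// mulf_neq0 ?gt_eqF.
- move=> h i; rewrite -(ler_pM2l T0); apply: le_trans (key h i) _.
  rewrite le_eqVlt; apply/orP; left; apply/eqP.
  by rewrite -/r; field; rewrite !gt_eqF.
Qed.

(** * Orthonormal bases of projections *)

Lemma outer_mulmx (R : realType) (n : nat) (u v x : 'cV[R]_n) :
  u *m v^T *m x = dot v x *: u.
Proof.
rewrite -mulmxA [v^T *m x]mx11_scalar mul_mx_scalar; congr (_ *: _).
by rewrite mxE; apply: eq_bigr => i _; rewrite mxE.
Qed.

(** Peel off one normalized column [v] of [Pi] at a time: [Pi - v v^T] is again an
orthogonal projection, of smaller rank, and it kills [v]. *)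
Lemma projection_orthonormal (R : realType) (n : nat) (Pi : 'M[R]_n) :
  Pi^T = Pi -> Pi *m Pi = Pi ->
  exists qs : seq 'cV[R]_n, [/\ orthonormal_seq qs, (size qs <= \rank Pi)%N,
    forall q, q \in qs -> Pi *m q = q &
    forall x, dot x (Pi *m x) = \sum_(q <- qs) dot q x ^+ 2].
Proof.
have [k] := ubnP (\rank Pi); elim: k Pi => // k IH Pi rk PiT PiPi.
have [Pi0|] := eqVneq Pi 0.
  exists [::]; split => //= x.
  by rewrite big_nil Pi0 mul0mx /dot big1// => i _; rewrite mxE mulr0.
move=> Pin0.
have [j colj] : exists j, col j Pi != 0.
  apply/existsP; apply: contraNT Pin0 => /existsPn h; apply/eqP/matrixP => i j.
  by have := h j; rewrite negbK => /eqP/colP/(_ i); rewrite !mxE.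
pose w := col j Pi; pose v := (Num.sqrt (dot w w))^-1 *: w.
have Piw : Pi *m w = w by rewrite /w colE mulmxA PiPi.
have Piv : Pi *m v = v by rewrite /v -scalemxAr Piw.
have ww : 0 < dot w w by rewrite lt_def dot_eq0 colj dot_ge0.
have vv : dot v v = 1.
  rewrite dotZl dotZr mulrA -invfM -expr2 sqr_sqrtr ?dot_ge0// mulVf//.
  by rewrite gt_eqF.
have vPi : v^T *m Pi = v^T by rewrite -{1}PiT -trmx_mul Piv.
pose Q := Pi - v *m v^T.
have QT : Q^T = Q by rewrite /Q linearB/= trmx_mul trmxK PiT.
have Qv : Q *m v = 0 by rewrite mulmxBl outer_mulmx vv scale1r Piv subrr.
have QPi : Q *m Pi = Q by rewrite mulmxBl PiPi -mulmxA vPi.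
have PiQ : Pi *m Q = Q by rewrite mulmxBr PiPi mulmxA Piv.
have QQ : Q *m Q = Q by rewrite {2}/Q mulmxBr QPi mulmxA Qv mul0mx subr0.
have rQ : (\rank Q < \rank Pi)%N.
  apply: rank_ltmx; rewrite ltmxE -{1}QPi submxMl /=.
  apply/negP => /submxP [Z ZQ].
  have vTv : v^T *m v = 0 by rewrite -{1}vPi ZQ -!mulmxA Qv !mulmx0.
  have := outer_mulmx v v v; rewrite -mulmxA vTv mulmx0 vv scale1r => /esym/eqP.
  by rewrite -dot_eq0 vv oner_eq0.
have [qs [oqs sqs Qqs xQ]] := IH Q (leq_trans rQ rk) QT QQ.
exists (v :: qs); split.
- split => // p pqs.
  by rewrite -(Qqs p pqs) -{1}QT -dot_mulmx Qv /dot big1// => i _; rewrite mxE mulr0.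
- exact: leq_ltn_trans sqs rQ.
- move=> q; rewrite inE => /predU1P [->//|qqs].
  by rewrite -{1}(Qqs q qqs) mulmxA PiQ Qqs.
- move=> x; rewrite big_cons -xQ mulmxBl outer_mulmx dotBr dotZr (dotC x v) -expr2.
  by rewrite addrC subrK.
Qed.

(** * Deviation bounds *)

Lemma markov_ge0 (R : realType) (d : measure_display) (T : measurableType d)
    (P : probability T R) (f : T -> R) (c K : R) :
  0 < c -> measurable_fun setT f -> (forall x, 0 <= f x) ->
  (\int[P]_x (f x)%:E = K%:E)%E ->
  measurable [set x | c <= f x] /\ (P [set x | (c <= f x)%R] <= (K / c)%:E)%E.
Proof.
move=> c0 mf f0 fK.
have mA : measurable [set x | c <= f x].
  rewrite (_ : [set x | _] = setT `&` f @^-1` `[c, +oo[).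
    exact: mf.
  by apply/seteqP; split => x /=; rewrite in_itv/= andbT; [|case].
split => //; rewrite EFinM lee_pdivlMr// muleC.
have -> : (P [set x | (c <= f x)%R] = \int[P]_x (\1_[set x | (c <= f x)%R] x)%:E)%E.
  by rewrite integral_indic// setIT.
rewrite -ge0_integral_scale ?(ltW c0)// -fK; apply: ge0_le_integral => //.
- by move=> x _; rewrite lee_fin mulr_ge0// ltW.
- by apply/measurable_EFinP; apply: measurable_funM.
- exact/measurable_EFinP.
- move=> x _; rewrite lee_fin indicE; have [|_] := boolP (x \in _).
    by rewrite inE /= mulr1.
  by rewrite mulr0.
Qed.

Lemma sqrtr_expR (R : realType) (z : R) : Num.sqrt (expR z) = expR (z / 2).
Proof.
by rewrite {1}(splitr z) expRD -expr2 sqrtr_sqr ger0_norm// expR_ge0.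
Qed.

Lemma invr_sqrt_le_expR (R : realType) (y : R) :
  0 < y -> (Num.sqrt y)^-1 <= expR ((y^-1 - 1) / 2).
Proof.
move=> y0; rewrite -sqrtr_expR -(sqrtrV (ltW y0)); apply: ler_wsqrtr.
by apply: le_trans (expR_ge1Dx _); rewrite addrC subrK.
Qed.

(** Chernoff's method.  With [A] the square root of the number of degrees of
freedom and [B = sqrt (2 a)], the bound log (1 / y) <= 1 / y - 1 on the moment
generating function and the choice [y = 1 - 2 s sigma^2 = A / (A + B)] give
the exponent [- B^2 / 2 = - a] exactly. *)
Lemma gaussian_proj_tail (R : realType) (d : measure_display) (T : measurableType d)
    (P : probability T R) (n : nat) (sigma : R) (eps : 'I_n -> {RV P >-> R})
    (qs : seq 'cV[R]_n) (a : R) :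
  0 < sigma -> gaussian_noise sigma eps -> orthonormal_seq qs -> 0 < a ->
  exists B : set T, [/\ measurable B, (P B <= (expR (- a))%:E)%E &
    forall x, ~ B x -> \sum_(q <- qs) dot q (\col_i eps i x) ^+ 2 <=
      (sigma * (Num.sqrt (size qs)%:R + Num.sqrt (2 * a))) ^+ 2].
Proof.
move=> s0 Heps oqs a0.
pose A : R := Num.sqrt (size qs)%:R; pose B : R := Num.sqrt (2 * a).
have B0 : 0 < B by rewrite sqrtr_gt0 mulr_gt0.
have B2 : B ^+ 2 = 2 * a by rewrite sqr_sqrtr// mulr_ge0// ltW.
have A2 : A ^+ 2 = (size qs)%:R by rewrite sqr_sqrtr.
have [qs0|qsn0] := posnP (size qs).
  exists set0; split => //; first by rewrite measure0 lee_fin expR_ge0.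
  by move=> x _; rewrite (size0nil qs0) big_nil sqr_ge0.
have A0 : 0 < A by rewrite sqrtr_gt0 ltr0n.
pose s := B / (2 * (A + B) * sigma ^+ 2).
have AB0 : 0 < A + B by rewrite addr_gt0.
have sge0 : 0 < s by rewrite divr_gt0// !mulr_gt0// exprn_gt0.
have Eq : 1 - 2 * s * sigma ^+ 2 = A / (A + B).
  by rewrite /s; field; rewrite !gt_eqF.
have q0 : 0 < 1 - 2 * s * sigma ^+ 2 by rewrite Eq divr_gt0.
pose Z x := \sum_(q <- qs) dot q (\col_i eps i x) ^+ 2.
have mZ : measurable_fun setT (fun x => expR (s * Z x)).
  apply: measurableT_comp; first exact: measurable_expR.
  apply: measurable_funM => //; apply: measurable_sum => q.
  by apply: measurable_funX; exact: measurable_dot.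
have EZ : (\int[P]_x (expR (s * Z x))%:E =
    ((Num.sqrt (1 - 2 * s * sigma ^+ 2))^-1 ^+ size qs)%:E)%E.
  have := gaussian_expR_proj (b := 0) s0 Heps (ltW sge0) q0 oqs.
  have d0 (q : 'cV[R]_n) : dot q 0 = 0.
    by rewrite /dot big1// => i _; rewrite mxE mulr0.
  rewrite d0 mulr0 mul0r expR0 mul1r => <- //.
  by apply: eq_integral => x _; rewrite dotC d0 add0r.
pose t := s * (sigma * (A + B)) ^+ 2.
have [mB PB] := markov_ge0 (expR_gt0 t) mZ (fun x => expR_ge0 _) EZ.
exists [set x | expR t <= expR (s * Z x)]; split => //.
  apply: le_trans PB _; rewrite lee_fin ler_pdivrMr ?expR_gt0// -expRD.
  apply: le_trans (lerXn2r _ _ _ (invr_sqrt_le_expR q0)) _.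
  - by rewrite nnegrE invr_ge0 sqrtr_ge0.
  - by rewrite nnegrE expR_ge0.
  rewrite -expRM_natl ler_expR Eq -A2 /t /s.
  rewrite le_eqVlt; apply/orP; left; apply/eqP.
  have -> : a = B ^+ 2 / 2 by rewrite B2; field.
  by field; rewrite !gt_eqF.
move=> x /negP; rewrite -ltNge ltr_expR /t ltr_pM2l// => /ltW.
by [].
Qed.

(** Chernoff's method with a negative exponent; the value [s = q / 4], where
[q = sqrt (8 a / n)], minimizes [n (2 s^2 - s q)], with minimum [- a]. *)
Lemma gaussian_norm_lower_tail (R : realType) (d : measure_display) (T : measurableType d)
    (P : probability T R) (n : nat) (sigma : R) (eps : 'I_n -> {RV P >-> R}) (a : R) :
  0 < sigma -> gaussian_noise sigma eps -> 0 < a -> 8 * a < n%:R ->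
  exists B : set T, [/\ measurable B, (P B <= (expR (- a))%:E)%E &
    forall x, ~ B x -> sigma ^+ 2 * (n%:R * (1 - Num.sqrt (8 * a / n%:R))) <=
      dot (\col_i eps i x) (\col_i eps i x)].
Proof.
move=> s0 Heps a0 an.
have n0 : 0 < n%:R :> R by apply: lt_trans an; rewrite mulr_gt0.
pose q := Num.sqrt (8 * a / n%:R).
have q0 : 0 < q by rewrite sqrtr_gt0 divr_gt0// mulr_gt0.
have q2 : q ^+ 2 = 8 * a / n%:R.
  by rewrite sqr_sqrtr// divr_ge0// ?mulr_ge0// ltW.
pose s := q / 4.
pose s' := - s / sigma ^+ 2.
have sE : 1 - 2 * s' * sigma ^+ 2 = 1 + 2 * s.
  by rewrite /s'; field; rewrite gt_eqF.
have sg0 : 0 < s by rewrite divr_gt0.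
have y0 : 0 < 1 + 2 * s by rewrite addr_gt0// mulr_gt0.
pose Z x := dot (\col_i eps i x) (\col_i eps i x).
have mZ : measurable_fun setT (fun x => expR (s' * Z x)).
  apply: measurableT_comp; first exact: measurable_expR.
  apply: measurable_funM => //; apply: measurable_sum => i.
  by under eq_fun do rewrite !mxE; apply: measurable_funM; exact: measurable_funP.
have EZ := @gaussian_expR_sqnorm _ _ _ P n sigma eps s' s0 Heps.
rewrite sE in EZ; have {}EZ := EZ y0.
pose t := - s * (n%:R * (1 - q)).
have [mB PB] := markov_ge0 (expR_gt0 t) mZ (fun x => expR_ge0 _) EZ.
exists [set x | expR t <= expR (s' * Z x)]; split => //.
  apply: le_trans PB _; rewrite lee_fin ler_pdivrMr ?expR_gt0// -expRD.
  apply: le_trans (lerXn2r _ _ _ (invr_sqrt_le_expR y0)) _.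
  - by rewrite nnegrE invr_ge0 sqrtr_ge0.
  - by rewrite nnegrE expR_ge0.
  rewrite -expRM_natl ler_expR.
  have -> : a = n%:R * q ^+ 2 / 8 by rewrite q2; field; rewrite gt_eqF.
  rewrite (_ : - (_ / 8) + t = n%:R * (2 * s ^+ 2 - s)); last first.
    by rewrite /t /s; field.
  rewrite ler_pM2l// ler_pdivrMr// lerBlDr -(ler_pM2r y0) mulVf ?gt_eqF//.
  have -> : ((2 * s ^+ 2 - s) * 2 + 1) * (1 + 2 * s) = 1 + 8 * s ^+ 3 by ring.
  by rewrite lerDl mulr_ge0// exprn_ge0// ltW.
move=> x /negP; rewrite -ltNge ltr_expR /t /s' !mulNr ltrN2 -mulrA ltr_pM2l//.
by rewrite [X in _ < X]mulrC ltr_pdivlMr ?exprn_gt0// mulrC => /ltW.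
Qed.

(** The exponential lies above its tangent at the weighted mean. *)
Lemma expR_jensen (R : realType) (k : nat) (p y : 'I_k -> R) :
  (forall i, 0 <= p i) -> \sum_i p i = 1 ->
  expR (\sum_i p i * y i) <= \sum_i p i * expR (y i).
Proof.
move=> p0 p1; set z := \sum_i p i * y i.
apply: (@le_trans _ _ (\sum_i p i * (expR z * (1 + (y i - z))))).
  rewrite (eq_bigr (fun i => expR z * (p i * (1 - z) + p i * y i))); last first.
    by move=> i _; ring.
  by rewrite -mulr_sumr big_split/= -mulr_suml p1 mul1r subrK mulr1.
apply: ler_sum => i _; rewrite ler_wpM2l//.
have -> : expR (y i) = expR z * expR (y i - z) by rewrite -expRD addrC subrK.
by rewrite ler_pM2l ?expR_gt0// expR_ge1Dx.
Qed.

(** A maximal inequality whose cost is the rank of [C] and not its number of rows.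
The exceptional set is the event that
[Z = p sum_i nu_i (exp (s X_i) + exp (- s X_i))] reaches [exp (u^2)]; for
[s = u / (sigma rho)] its mean is at most [2 p exp (u^2 / 2)].  Outside of it,
Jensen's inequality for the probability vector [q_i = |y_i| / |y|_1 <= p nu_i],
[y = C h], shows that the normalized left-hand side [z] satisfies
[exp (s z) < exp (u^2)]. *)
Lemma gaussian_weighted_l1 (R : realType) (d : measure_display) (T : measurableType d)
    (P : probability T R) (n k : nat) (sigma : R) (eps : 'I_n -> {RV P >-> R})
    (C : 'M[R]_(k, n)) (v : 'I_k -> 'cV[R]_n) (p rho u : R) :
  0 < sigma -> gaussian_noise sigma eps -> 0 < rho -> 0 < u ->
  (\rank C)%:R <= p -> (forall i, dot (v i) (v i) <= rho ^+ 2) ->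
  exists B : set T, [/\ measurable B,
    (P B <= (2 * p * expR (- (u ^+ 2 / 2)))%:E)%E &
    forall x, ~ B x -> forall h : 'cV[R]_n,
      \sum_i dot (v i) (\col_j eps j x) * (C *m h) i 0 <=
      sigma * rho * u * \sum_i `|(C *m h) i 0|].
Proof.
move=> s0 Heps rho0 u0 Cp vrho.
have p0 : 0 <= p by apply: le_trans Cp.
have [nu [nu0 nu1 Cnu]] := leverage_weights C.
pose s := u / (sigma * rho).
have s_gt0 : 0 < s by rewrite divr_gt0// mulr_gt0.
pose X i x := dot (v i) (\col_j eps j x).
pose E i x := expR (s * X i x) + expR (- s * X i x).
pose Z x := p * \sum_i nu i * E i x.
have mexp i (b : R) : measurable_fun setT (fun x => expR (b * X i x)).
  apply: measurableT_comp; first exact: measurable_expR.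
  by apply: measurable_funM => //; exact: measurable_dot.
have mE i : measurable_fun setT (E i) by apply: measurable_funD; exact: mexp.
have E0 i x : 0 <= E i x by rewrite addr_ge0 ?expR_ge0.
have mZ : measurable_fun setT Z.
  apply: measurable_funM => //; apply: measurable_sum => i.
  exact: measurable_funM.
have Z0 x : 0 <= Z x.
  by rewrite mulr_ge0// sumr_ge0// => i _; rewrite mulr_ge0.
have mgf i (b : R) : b ^+ 2 = s ^+ 2 ->
    (\int[P]_x (expR (b * X i x))%:E <= (expR (u ^+ 2 / 2))%:E)%E.
  move=> bs.
  have -> : (\int[P]_x (expR (b * X i x))%:E =
      \int[P]_x (expR (dot (b *: v i) (\col_j eps j x)))%:E)%E.
    by apply: eq_integral => x _; rewrite dotZl.
  rewrite (gaussian_expR_dot _ s0 Heps) lee_fin ler_expR dotZl dotZr ler_pM2r//.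
  rewrite (mulrA b) -expr2 bs.
  apply: (@le_trans _ _ (sigma ^+ 2 * (s ^+ 2 * rho ^+ 2))).
    by rewrite ler_pM2l ?exprn_gt0// ler_pM2l ?exprn_gt0.
  by rewrite le_eqVlt; apply/orP; left; apply/eqP; rewrite /s; field; rewrite !gt_eqF.
have EE i : (\int[P]_x (E i x)%:E <= (2 * expR (u ^+ 2 / 2))%:E)%E.
  rewrite /E; under eq_integral do rewrite EFinD.
  rewrite ge0_integralD//; [|exact/measurable_EFinP..].
  by rewrite mulr_natl mulr2n EFinD; apply: leeD; apply: mgf; rewrite ?sqrrN.
pose K := fine (\int[P]_x (Z x)%:E)%E.
have ZK' : (\int[P]_x (Z x)%:E <= (2 * p * expR (u ^+ 2 / 2))%:E)%E.
  rewrite ge0_integral_scale//; last 2 first.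
  - by apply: measurable_sum => i; exact: measurable_funM.
  - by move=> x; rewrite sumr_ge0// => i _; rewrite mulr_ge0.
  under eq_integral do rewrite -sumEFin.
  rewrite ge0_integral_sum//; last 2 first.
  - by move=> i; apply/measurable_EFinP; exact: measurable_funM.
  - by move=> i x _; rewrite lee_fin mulr_ge0.
  apply: (@le_trans _ _ (p%:E * \sum_i (nu i * (2 * expR (u ^+ 2 / 2)))%:E)%E).
    apply: lee_wpmul2l; first by rewrite lee_fin.
    apply: lee_sum => i _; rewrite ge0_integral_scale// EFinM.
    by apply: lee_wpmul2l; rewrite ?lee_fin.
  rewrite sumEFin -EFinM lee_fin -mulr_suml.
  have -> : 2 * p * expR (u ^+ 2 / 2) = p * (1 * (2 * expR (u ^+ 2 / 2))) by ring.
  by rewrite ler_wpM2l// ler_wpM2r// mulr_ge0// expR_ge0.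
have ZK : (\int[P]_x (Z x)%:E = K%:E)%E.
  rewrite fineK// ge0_fin_numE; first by apply: le_lt_trans ZK' _; rewrite ltry.
  by apply: integral_ge0 => x _; rewrite lee_fin.
have [mB PB] := markov_ge0 (expR_gt0 (u ^+ 2)) mZ Z0 ZK.
exists [set x | expR (u ^+ 2) <= Z x]; split => //.
  apply: le_trans PB _; rewrite lee_fin ler_pdivrMr ?expR_gt0//.
  rewrite -(mulrA (2 * p)) -expRD (_ : - (u ^+ 2 / 2) + u ^+ 2 = u ^+ 2 / 2); last by field.
  by rewrite -lee_fin -ZK.
move=> x /negP; rewrite -ltNge => Zu h.
set N := \sum_i `|(C *m h) i 0|.
have N0 : 0 <= N by exact: sumr_ge0.
have [N00|Nn0] := eqVneq N 0.
  have C0 i : (C *m h) i 0 = 0.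
    apply/eqP; rewrite -normr_eq0.
    by move/eqP: N00; rewrite psumr_eq0// => /allP/(_ i (mem_index_enum _)).
  by rewrite N00 mulr0 big1// => i _; rewrite C0 mulr0.
have Ngt0 : 0 < N by rewrite lt_def Nn0.
pose q i := `|(C *m h) i 0| / N.
have q0 i : 0 <= q i by rewrite divr_ge0.
have q1 : \sum_i q i = 1 by rewrite -mulr_suml divff.
have qnu i : q i <= p * nu i.
  rewrite ler_pdivrMr//; apply: le_trans (Cnu h i) _.
  by rewrite ler_wpM2r// ler_wpM2r.
pose y i := s * (Num.sg ((C *m h) i 0) * X i x).
have yE i : expR (y i) <= E i x.
  rewrite /y /E; case: sgrP => _.
  - rewrite mul0r mulr0 expR0 mulNr expRN.
    have := expR_gt0 (s * X i x); set e := expR _ => e0.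
    rewrite -(ler_pM2r e0) mulrDl mulVf ?gt_eqF// mul1r.
    by have := sqr_ge0 (e - 1); nra.
  - by rewrite mul1r lerDl expR_ge0.
  - by rewrite mulN1r mulrN -mulNr lerDr expR_ge0.
have := expR_jensen y q0 q1.
have -> : \sum_i q i * y i = s * (\sum_i X i x * (C *m h) i 0) / N.
  rewrite mulr_sumr mulr_suml; apply: eq_bigr => i _.
  rewrite /q /y [in RHS](numEsg ((C *m h) i 0)); ring.
move=> J; suff : s * (\sum_i X i x * (C *m h) i 0) / N < u ^+ 2.
  rewrite ltr_pdivrMr// /s mulrAC ltr_pdivrMr ?mulr_gt0// => hh.
  apply: ltW; rewrite -(ltr_pM2l u0); apply: lt_le_trans hh _.
  by rewrite le_eqVlt; apply/orP; left; apply/eqP; ring.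
rewrite -ltr_expR; apply: le_lt_trans Zu; apply: le_trans J _.
rewrite /Z mulr_sumr; apply: ler_sum => i _.
by rewrite mulrA ler_pM// expR_ge0.
Qed.

(** * Norms and stationarity of the estimator *)

Lemma dot_cauchy_schwarz (R : realType) (n : nat) (u v : 'cV[R]_n) :
  dot u v ^+ 2 <= dot u u * dot v v.
Proof.
have [->|v0] := eqVneq v 0.
  have d0 (w : 'cV[R]_n) : dot w 0 = 0.
    by rewrite /dot big1// => i _; rewrite mxE mulr0.
  by rewrite !d0 expr0n mulr0.
have vv : 0 < dot v v by rewrite lt_def dot_eq0 v0 dot_ge0.
have := dot_ge0 (dot v v *: u - dot u v *: v).
rewrite !(dotBl, dotBr, dotZl, dotZr) (dotC v u).
set a := dot u u; set b := dot u v; set c := dot v v.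
rewrite (_ : _ - _ = c * (a * c - b ^+ 2)); last by ring.
by rewrite pmulr_rge0// subr_ge0.
Qed.

Lemma normn_ge0 (R : realType) (n : nat) (f : 'cV[R]_n) : 0 <= normn f.
Proof. exact: sqrtr_ge0. Qed.

Lemma sqr_normn (R : realType) (n : nat) (f : 'cV[R]_n) :
  normn f ^+ 2 = dot f f / n%:R.
Proof.
rewrite sqr_sqrtr; last by apply: sumr_ge0 => i _; rewrite divr_ge0// sqr_ge0.
by rewrite /dot mulr_suml; apply: eq_bigr => i _; rewrite expr2.
Qed.

Lemma dot_le_normn (R : realType) (n : nat) (u v : 'cV[R]_n) :
  dot u v / n%:R <= normn u * normn v.
Proof.
apply: le_trans (ler_norm _) _.
rewrite -(@ler_pXn2r _ 2)// ?nnegrE ?normr_ge0 ?mulr_ge0 ?normn_ge0//.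
rewrite exprMn !sqr_normn real_normK ?num_real//.
rewrite [leLHS](_ : _ = dot u v ^+ 2 * n%:R^-1 ^+ 2); last by ring.
rewrite [leRHS](_ : _ = dot u u * dot v v * n%:R^-1 ^+ 2); last by ring.
by rewrite ler_wpM2r ?sqr_ge0// dot_cauchy_schwarz.
Qed.

Lemma normnN (R : realType) (n : nat) (u : 'cV[R]_n) : normn (- u) = normn u.
Proof. by congr Num.sqrt; apply: eq_bigr => i _; rewrite mxE sqrrN. Qed.

Lemma normnZ (R : realType) (n : nat) (a : R) (u : 'cV[R]_n) :
  normn (a *: u) ^+ 2 = a ^+ 2 * normn u ^+ 2.
Proof. by rewrite !sqr_normn dotZl dotZr; ring. Qed.

Lemma ler_normnD (R : realType) (n : nat) (u v : 'cV[R]_n) :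
  normn (u + v) <= normn u + normn v.
Proof.
rewrite -(@ler_pXn2r _ 2)// ?nnegrE ?addr_ge0 ?normn_ge0//.
rewrite sqrrD !sqr_normn dotDl !dotDr (dotC v u).
have := dot_le_normn u v; set N := normn u * normn v => h.
rewrite !mulrDl mulr2n; lra.
Qed.

Lemma norm1_ge0 (R : realType) (n : nat) (u : 'cV[R]_n) : 0 <= norm1 u.
Proof. exact: sumr_ge0. Qed.

Lemma ler_norm1D (R : realType) (n : nat) (u v : 'cV[R]_n) :
  norm1 (u + v) <= norm1 u + norm1 v.
Proof.
by rewrite /norm1 -big_split; apply: ler_sum => i _; rewrite mxE ler_normD.
Qed.

Lemma norm1Z (R : realType) (n : nat) (a : R) (u : 'cV[R]_n) :
  norm1 (a *: u) = `|a| * norm1 u.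
Proof. by rewrite /norm1 mulr_sumr; apply: eq_bigr => i _; rewrite mxE normrM. Qed.

Lemma norm1N (R : realType) (n : nat) (u : 'cV[R]_n) : norm1 (- u) = norm1 u.
Proof. by apply: eq_bigr => i _; rewrite mxE normrN. Qed.

(** One-sided derivative of the objective at its minimizer, along the segment to
[f].  The norm is differentiable only when the residual does not vanish;
otherwise both sides are 0. *)
Lemma sqrt_analysis_stationarity (R : realType) (m n : nat) (D : 'M[R]_(m, n))
    (lambda0 : R) (Y fhat f : 'cV[R]_n) :
  0 <= lambda0 -> is_sqrt_analysis D lambda0 Y fhat ->
  dot (Y - fhat) (f - fhat) / n%:R <=
  normn (Y - fhat) * (lambda0 * (norm1 (D *m f) - norm1 (D *m fhat))).
Proof.
move=> l0 Hmin; set e := normn (Y - fhat); set K := lambda0 * _.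
set g := f - fhat.
have := normn_ge0 (Y - fhat); rewrite -/e le_eqVlt => /predU1P [e0|e0].
  by have := dot_le_normn (Y - fhat) g; rewrite -/e -e0 !mul0r.
rewrite leNgt; apply/negP => Hlt.
set ip := dot _ _ / _ in Hlt.
pose delta := ip - e * K; pose G := normn g ^+ 2.
have d0 : 0 < delta by rewrite subr_gt0.
have G0 : 0 <= G by rewrite sqr_ge0.
have K1 : 0 < `|K| + 1 by rewrite ltr_wpDl.
(* A step so small that [e - t K >= 0], which allows squaring, and that the
   second-order term [t G] stays below [delta]. *)
pose t := Num.min 1 (Num.min (e / (`|K| + 1)) (delta / (G + 1))).
have t0 : 0 < t by rewrite !lt_min ltr01 !divr_gt0// ltr_wpDl.
have t1 : t <= 1 by rewrite ge_min lexx.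
have tK : t * (`|K| + 1) <= e.
  by rewrite -ler_pdivlMr// !ge_min lexx orbT.
have tG : t * (G + 1) <= delta.
  by rewrite -ler_pdivlMr ?ltr_wpDl// !ge_min lexx !orbT.
have := Hmin (fhat + t *: g); rewrite /sqrt_analysis_objective -/e.
have -> : Y - (fhat + t *: g) = Y - fhat - t *: g by rewrite opprD addrA.
have Dc : norm1 (D *m (fhat + t *: g)) <=
    (1 - t) * norm1 (D *m fhat) + t * norm1 (D *m f).
  have -> : fhat + t *: g = (1 - t) *: fhat + t *: f.
    by rewrite /g scalerBr scalerBl scale1r addrA addrAC.
  rewrite mulmxDr -!scalemxAr; apply: le_trans (ler_norm1D _ _) _.
  by rewrite !norm1Z !ger0_norm ?subr_ge0// ltW.
move=> Hm.
have {Hm} Hm : e - t * K <= normn (Y - fhat - t *: g).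
  have := ler_wpM2l l0 Dc; rewrite /K; lra.
have KK := ler_norm K.
have eK0 : 0 <= e - t * K by nra.
have : (e - t * K) ^+ 2 <= normn (Y - fhat - t *: g) ^+ 2.
  by rewrite ler_pXn2r// nnegrE normn_ge0.
have sqB (w z : 'cV[R]_n) : normn (w - t *: z) ^+ 2 =
    normn w ^+ 2 - 2 * t * (dot w z / n%:R) + t ^+ 2 * normn z ^+ 2.
  by rewrite !sqr_normn !(dotBl, dotBr, dotZl, dotZr) (dotC z w); ring.
rewrite sqB -/e -/G -/ip.
move=> Hsq.
have : 2 * t * delta <= t ^+ 2 * (G - K ^+ 2) by rewrite /delta; lra.
have -> : 2 * t * delta = t * (2 * delta) by ring.
have -> : t ^+ 2 * (G - K ^+ 2) = t * (t * (G - K ^+ 2)) by ring.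
rewrite ler_pM2l// => H2.
have : t * (G - K ^+ 2) <= t * (G + 1).
  by rewrite ler_pM2l//; have := sqr_ge0 K; lra.
lra.
Qed.

(** The arithmetic behind the lower bound on the residual norm [rho]: here [E] is
the norm of the noise, [x] that of [fhat - f0], and [b], [bh] are the penalties
at [f0] and [fhat].  If [rho] were below [(1 - delta) E], then [y = E - rho] would
exceed [delta E], and eliminating [x] and [bh] from the quadratic inequality
would leave [(delta - p) y <= 2 (1 - delta) b], which the size of [c] excludes. *)
Lemma residual_lower_bound (R : realFieldType) (E x rho b bh p c delta : R) :
  0 < E -> 0 <= x -> 0 <= rho -> 0 <= b -> 0 <= bh -> 0 <= p -> p < delta ->
  delta < 1 -> 4 * c <= (delta - p) ^+ 2 ->
  x ^+ 2 <= p * E * x + (1 - delta) * E * (bh + b) + rho * (b - bh) ->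
  rho + bh <= E + b -> E - rho <= x -> b <= c * E ->
  (1 - delta) * E <= rho.
Proof.
move=> E0 x0 rho0 b0 bh0 p0 pd d1 hc H1 H2 H3 H4.
rewrite leNgt; apply/negP => Hlt.
pose y := E - rho.
have yd : delta * E < y by rewrite /y; lra.
have pEy : p * E < y by apply: lt_trans yd; rewrite ltr_pM2r.
have m1 : y ^+ 2 - p * E * y <= x ^+ 2 - p * E * x.
  have : 0 <= (x - y) * (x + y - p * E).
    by apply: mulr_ge0; rewrite subr_ge0// /y; nra.
  by nra.
have m2 : ((1 - delta) * E - rho) * bh <= ((1 - delta) * E - rho) * (y + b).
  by rewrite ler_pM2l ?subr_gt0// /y; lra.
have m3 : (delta - p) * (E * y) <= 2 * (1 - delta) * b * E.
  by rewrite /y in m1 m2 *; nra.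
have m4 : (delta - p) * y <= 2 * (1 - delta) * b.
  by rewrite -(ler_pM2r E0); apply: le_trans m3; rewrite le_eqVlt; apply/orP; left; apply/eqP; ring.
have dp0 : 0 < delta - p by lra.
have m5 : (delta - p) * (delta * E) < (delta - p) * y by rewrite ltr_pM2l.
have m6 : 2 * (1 - delta) * b <= 2 * b.
  by nra.
have m7 : 4 * b <= (delta - p) ^+ 2 * E.
  apply: le_trans (ler_wpM2r (ltW E0) hc); lra.
have m8 : (delta - p) ^+ 2 * E <= (delta - p) * (delta * E).
  by rewrite expr2 -mulrA ler_pM2l// ler_pM2r//; lra.
have : 0 < (delta - p) * (delta * E) by rewrite !mulr_gt0//; lra.
lra.
Qed.

(** * Projection, weights and compatibility *)

Lemma rows_of_mulmx (R : realType) (m n : nat) (D : 'M[R]_(m, n)) (S : {set 'I_m})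
    (h : 'cV[R]_n) j : (rows_of S D *m h) j 0 = (D *m h) (enum_val j) 0.
Proof. by rewrite !mxE; apply: eq_bigr => k _; rewrite mxE. Qed.

Lemma norm1_rows_of (R : realType) (m n : nat) (D : 'M[R]_(m, n)) (S : {set 'I_m})
    (h : 'cV[R]_n) :
  norm1 (D *m h) = norm1 (rows_of S D *m h) + norm1 (rows_of (~: S)%SET D *m h).
Proof.
rewrite /norm1 (bigID (fun i => i \in S))/=; congr (_ + _).
  by rewrite big_enum_val; apply: eq_bigr => j _; rewrite rows_of_mulmx.
rewrite (eq_bigl (fun i => i \in (~: S)%SET)); last by move=> i; rewrite inE.
by rewrite big_enum_val; apply: eq_bigr => j _; rewrite rows_of_mulmx.
Qed.

Lemma nulldim_rank (R : realType) (m n : nat) (D : 'M[R]_(m, n)) (S : {set 'I_m}) :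
  (n%:R - (nulldim D S)%:R : R) = (\rank (rows_of (~: S)%SET D))%:R.
Proof.
rewrite /nulldim mxrank_ker mxrank_tr natrB ?rank_leq_col//; ring.
Qed.

Definition null_proj (R : realType) (k n : nat) (A : 'M[R]_(k, n)) : 'M[R]_n :=
  1%:M - Defs.pinv A *m A.

Lemma null_proj_tr (R : realType) (k n : nat) (A : 'M[R]_(k, n)) :
  (null_proj A)^T = null_proj A.
Proof. by have [_ _ _ XA] := Defs.pinvP A; rewrite linearB/= trmx1 XA. Qed.

Lemma mulmx_null_proj (R : realType) (k n : nat) (A : 'M[R]_(k, n)) :
  A *m null_proj A = 0.
Proof. by have [AXA _ _ _] := Defs.pinvP A; rewrite mulmxBr mulmx1 mulmxA AXA subrr. Qed.

Lemma null_proj_idem (R : realType) (k n : nat) (A : 'M[R]_(k, n)) :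
  null_proj A *m null_proj A = null_proj A.
Proof.
by rewrite {1}/null_proj mulmxBl mul1mx -mulmxA mulmx_null_proj mulmx0 subr0.
Qed.

Lemma rank_null_proj (R : realType) (m n : nat) (D : 'M[R]_(m, n)) (S : {set 'I_m}) :
  (\rank (null_proj (rows_of (~: S)%SET D)) <= nulldim D S)%N.
Proof.
apply: mxrankS; apply/sub_kermxP.
by rewrite -[X in X *m _]null_proj_tr -trmx_mul mulmx_null_proj trmx0.
Qed.

Lemma omega_ge0 (R : realType) (m n : nat) (D : 'M[R]_(m, n)) S i :
  0 <= omega D S i.
Proof. by rewrite /omega; case: pickP => // *; exact: normn_ge0. Qed.

Lemma gamma_ge0 (R : realType) (m n : nat) (D : 'M[R]_(m, n)) S :
  0 <= gamma D S.
Proof. exact: bigmax_ge_id. Qed.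

Lemma omega_le_gamma (R : realType) (m n : nat) (D : 'M[R]_(m, n)) S i :
  i \in (~: S)%SET -> omega D S i <= gamma D S.
Proof. by move=> iS; rewrite /gamma; apply: le_bigmax_cond. Qed.

Lemma omega_gammaE (R : realType) (m n : nat) (D : 'M[R]_(m, n)) S i :
  i \in (~: S)%SET -> omega D S i = gamma D S * (omega D S i / gamma D S).
Proof.
move=> iS; have [g0|g0] := eqVneq (gamma D S) 0; last by field.
apply/eqP; rewrite g0 mul0r eq_le omega_ge0 andbT -g0; exact: omega_le_gamma.
Qed.

(** The sum of (1 - w_i) |(D h)_i| over [i] outside [S], the part of the penalty
which absorbs the noise. *)
Definition noise_penalty (R : realType) (m n : nat) (D : 'M[R]_(m, n)) S
    (h : 'cV[R]_n) : R :=
  \sum_(j < #|(~: S)%SET|) omega D S (enum_val j) / gamma D S *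
    `|(rows_of (~: S)%SET D *m h) j 0|.

Lemma norm1_weighted (R : realType) (m n : nat) (D : 'M[R]_(m, n)) S (h : 'cV[R]_n) :
  norm1 (diag_block (~: S)%SET (weights D S) *m rows_of (~: S)%SET D *m h) =
  norm1 (rows_of (~: S)%SET D *m h) - noise_penalty D S h.
Proof.
rewrite -mulmxA (_ : diag_block _ _ =
  diag_mx (\row_j (1 - omega D S (enum_val j) / gamma D S))); last first.
  apply/matrixP => i j; rewrite !mxE (inj_eq enum_val_inj).
  by case: eqP => [->|].
rewrite /norm1 /noise_penalty -sumrB; apply: eq_bigr => j _.
rewrite mul_diag_mx !mxE normrM ger0_norm; first by rewrite mulrBl mul1r.
have := omega_le_gamma D (enum_valP j); have := gamma_ge0 D S.
rewrite subr_ge0 le_eqVlt => /predU1P [<-|g0 h1]; first by rewrite invr0 mulr0.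
by rewrite ler_pdivrMr// mul1r.
Qed.

Lemma noise_penalty_le (R : realType) (m n : nat) (D : 'M[R]_(m, n)) S (h : 'cV[R]_n) :
  noise_penalty D S h <= norm1 (rows_of (~: S)%SET D *m h).
Proof. by rewrite -subr_ge0 -norm1_weighted norm1_ge0. Qed.

(** Reads the extended-real compatibility constant as an inequality between
seminorms, with [z = sqrt r / kappa].  The constraint set is empty exactly when
the left-hand side is never positive; when the null space is trivial, an active
set must be empty, and the quotient 0 / 0 of the statement is 0. *)
Lemma compatibility (R : realType) (m n : nat) (D : 'M[R]_(m, n)) (S : {set 'I_m})
    (W : 'M[R]_m) (lambda0 : R) :
  S \in active_sets D -> 0 < lambda0 ->
  let r : R := (nulldim D S)%:R in
  let G h := norm1 (rows_of S D *m h)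
           - norm1 (diag_block (~: S)%SET W *m rows_of (~: S)%SET D *m h) in
  ((4 * lambda0 * Num.sqrt r)%:E / kappa D S W = +oo)%E \/
  exists2 z : R, 0 <= z /\
    ((4 * lambda0 * Num.sqrt r)%:E / kappa D S W = (4 * lambda0 * z)%:E)%E &
    forall h, G h <= z * normn h.
Proof.
move=> HS l0 r G.
have Gz (a : R) (h : 'cV[R]_n) : 0 < a -> G (a *: h) = a * G h.
  move=> a0; rewrite /G -!scalemxAr !norm1Z gtr0_norm//; ring.
have scaled h : 0 < G h -> kappa_feasible D S W ((G h)^-1 *: h).
  move=> Gh; rewrite /kappa_feasible /= -/(G _) Gz ?invr_gt0//.
  by rewrite mulVf// gt_eqF.
have [r0|rn0] := eqVneq (nulldim D S) 0%N.
  right; exists 0; first split => //.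
    by rewrite /kappa /kappa2 /r r0 !(mul0e, sqrte0, sqrtr0, mulr0).
  move=> h; rewrite mul0r.
  suff S0 : forall j, j \notin S.
    rewrite /G (_ : norm1 (rows_of S D *m h) = 0) ?sub0r ?oppr_le0 ?norm1_ge0//.
    rewrite /norm1 big1// => j _; exfalso.
    by have := enum_valP j; rewrite (negbTE (S0 _)).
  move: HS; rewrite inE => -[f Sf].
  suff f0 : f = 0.
    by move=> j; rewrite Sf inE f0 mulmx0 eqxx.
  move/eqP: r0; rewrite /nulldim mxrank_eq0 kermx_eq0 => free.
  apply: (can_inj (@trmxK _ _ _)); rewrite trmx0; apply: (row_free_inj free).
  rewrite mul0mx -trmx_mul -trmx0; congr (_^T); apply/colP => j.
  rewrite rows_of_mulmx !mxE.
  have : enum_val j \notin active D f by rewrite -Sf; have := enum_valP j; rewrite inE.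
  rewrite inE negbK => /eqP/matrixP/(_ 0 0); rewrite !mxE => E.
  by apply: etrans E; apply: eq_bigr => k _; rewrite !mxE.
have r0 : 0 < r by rewrite ltr0n lt0n.
have sr0 : 0 < Num.sqrt r by rewrite sqrtr_gt0.
pose I := ereal_inf [set (normn f ^+ 2)%:E | f in kappa_feasible D S W].
have I0 : (0 <= I)%E.
  by apply: le_ereal_inf_tmp => _ [f _ <-]; rewrite lee_fin sqr_ge0.
have Ile f : kappa_feasible D S W f -> (I <= (normn f ^+ 2)%:E)%E.
  by move=> Ff; apply: ereal_inf_lbound; exists f.
have kE : kappa D S W = sqrte (r%:E * I)%E by [].
case: (I) I0 Ile kE => [i| |] I0 Ile kE; last by [].
- move: I0; rewrite lee_fin le_eqVlt => /predU1P [i0|i0].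
    left; rewrite kE -i0 mule0 sqrte0 inve0 gt0_muley// lte_fin.
    by rewrite !mulr_gt0.
  right; exists (Num.sqrt i)^-1; first split.
  + by rewrite invr_ge0 sqrtr_ge0.
  + rewrite kE -EFinM /= inver gt_eqF ?sqrtr_gt0 ?mulr_gt0//.
    rewrite -EFinM; congr (_%:E); rewrite sqrtrM ?ltW//; field.
    by rewrite !gt_eqF ?sqrtr_gt0.
  + move=> h; have [Gh|Gh] := leP (G h) 0.
      by apply: le_trans Gh _; rewrite mulr_ge0 ?normn_ge0// invr_ge0 sqrtr_ge0.
    have := Ile _ (scaled h Gh); rewrite lee_fin normnZ => Hi.
    have si0 : 0 < Num.sqrt i by rewrite sqrtr_gt0.
    rewrite ler_pdivlMl// -(@ler_pXn2r _ 2)//; last 2 first.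
    * by rewrite nnegrE ltW// mulr_gt0.
    * by rewrite nnegrE normn_ge0.
    rewrite exprMn (sqr_sqrtr (ltW i0)) -ler_pdivlMr ?exprn_gt0//.
    by rewrite mulrC -exprVn.
- right; exists 0; first split => //.
    by rewrite kE gt0_muley ?lte_fin//= invey mule0 mulr0.
  move=> h; rewrite mul0r leNgt; apply/negP => Gh.
  by have := Ile _ (scaled h Gh); rewrite leye_eq.
Qed.

(** * The deterministic oracle inequality *)

(** Stationarity at [f0]: the noise along the rows of [D] outside [S] is bounded by
|D fhat|_1 + |D f0|_1, and the first of these penalties is controlled by
comparing the objective at [fhat] and at [f0]. *)
Lemma residual_lower (R : realType) (m n : nat) (D : 'M[R]_(m, n)) (S : {set 'I_m})
    (lambda0 sigma eta P p c : R) (f0 e fhat : 'cV[R]_n) :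
  0 < lambda0 -> 0 < sigma -> 0 < eta < 1 ->
  is_sqrt_analysis D lambda0 (f0 + e) fhat ->
  (forall h, dot e h / n%:R <=
     P * normn h + (1 - eta) * sigma * lambda0 * noise_penalty D S h) ->
  0 < normn e -> (1 - eta) * sigma <= (1 - eta / 2) * normn e ->
  P <= p * normn e -> 0 <= p -> p < eta / 2 -> 4 * c <= (eta / 2 - p) ^+ 2 ->
  lambda0 * norm1 (D *m f0) <= c * normn e ->
  (1 - eta / 2) * normn e <= normn (f0 + e - fhat).
Proof.
move=> l0 s0 /andP[eta0 eta1] Hmin noise e0 se Pp p0 pe hc hb.
have H2 : normn (f0 + e - fhat) + lambda0 * norm1 (D *m fhat) <=
    normn e + lambda0 * norm1 (D *m f0).
  by have := Hmin f0; rewrite /sqrt_analysis_objective [f0 + e - f0]addrAC subrr add0r.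
have eE : e = f0 + e - fhat + (fhat - f0) by rewrite addrA subrK addrAC subrr add0r.
have H3 : normn e - normn (f0 + e - fhat) <= normn (fhat - f0).
  by rewrite lerBlDl {1}eE ler_normnD.
apply: (@residual_lower_bound _ _ (normn (fhat - f0)) _ (lambda0 * norm1 (D *m f0))
  (lambda0 * norm1 (D *m fhat)) p c) => //.
- exact: normn_ge0.
- exact: normn_ge0.
- by rewrite mulr_ge0 ?norm1_ge0// ltW.
- by rewrite mulr_ge0 ?norm1_ge0// ltW.
- lra.
have th : noise_penalty D S (fhat - f0) <= norm1 (D *m fhat) + norm1 (D *m f0).
  apply: le_trans (noise_penalty_le _ _ _) _.
  apply: (@le_trans _ _ (norm1 (D *m (fhat - f0)))).
    by rewrite [leRHS](norm1_rows_of D S) lerDr norm1_ge0.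
  by rewrite mulmxBr; apply: le_trans (ler_norm1D _ _) _; rewrite norm1N.
have th0 : 0 <= norm1 (D *m fhat) + norm1 (D *m f0) by rewrite addr_ge0 ?norm1_ge0.
have := sqrt_analysis_stationarity f0 (ltW l0) Hmin.
have -> : dot (f0 + e - fhat) (f0 - fhat) / n%:R =
    normn (fhat - f0) ^+ 2 - dot e (fhat - f0) / n%:R.
  rewrite sqr_normn -mulrBl; congr (_ / _).
  have -> : f0 + e - fhat = e - (fhat - f0) by rewrite opprB addrCA addrA.
  rewrite -[f0 - fhat]opprB; move: (fhat - f0) => h.
  by rewrite dotNr dotBl; ring.
have := noise (fhat - f0).
have : P * normn (fhat - f0) <= p * normn e * normn (fhat - f0).
  by rewrite ler_wpM2r ?normn_ge0.
have : (1 - eta) * sigma * lambda0 * noise_penalty D S (fhat - f0) <=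
    (1 - eta / 2) * normn e * (lambda0 * norm1 (D *m fhat) + lambda0 * norm1 (D *m f0)).
  rewrite -mulrDr mulrA -!(mulrA _ lambda0).
  apply: (@le_trans _ _ ((1 - eta) * sigma *
     (lambda0 * (norm1 (D *m fhat) + norm1 (D *m f0))))).
    by rewrite ler_wpM2l ?ler_pM2l// mulr_ge0 ?(ltW s0)//; lra.
  by rewrite ler_wpM2r// mulr_ge0// ltW.
lra.
Qed.

(** By the triangle inequality on [S] and on its complement, the penalty
difference plus the penalty spent on the noise is at most the compatibility
functional of [h = fhat - f] plus twice the penalty of [f] outside [S]; the
square of the norm of [h] left over by the stationarity inequality absorbs the
terms linear in [h]. *)
Lemma oracle_inequality (R : realType) (m n : nat) (D : 'M[R]_(m, n)) (S : {set 'I_m})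
    (lambda0 sigma eta P p z : R) (f0 e fhat f : 'cV[R]_n) :
  0 < lambda0 -> 0 < sigma -> eta < 1 ->
  is_sqrt_analysis D lambda0 (f0 + e) fhat ->
  (forall h, dot e h / n%:R <=
     P * normn h + (1 - eta) * sigma * lambda0 * noise_penalty D S h) ->
  (1 - eta) * sigma <= normn (f0 + e - fhat) <= 2 * sigma ->
  0 <= P <= sigma * p -> 0 <= z ->
  (forall h, norm1 (rows_of S D *m h) -
     norm1 (diag_block (~: S)%SET (weights D S) *m rows_of (~: S)%SET D *m h)
     <= z * normn h) ->
  normn (fhat - f0) ^+ 2 <= normn (f - f0) ^+ 2
    + 16 * sigma * lambda0 * norm1 (rows_of (~: S)%SET D *m f)
    + sigma ^+ 2 * (p + 4 * lambda0 * z) ^+ 2.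
Proof.
move=> l0 s0 eta1 Hmin noise /andP[rho1 rho2] /andP[P0 Pp] z0 compat.
set h := fhat - f; set A := rows_of (~: S)%SET D; set rho := normn _ in rho1 rho2.
have := sqrt_analysis_stationarity f (ltW l0) Hmin; rewrite -/rho.
have -> : dot (f0 + e - fhat) (f - fhat) / n%:R =
    (normn (fhat - f0) ^+ 2 + normn h ^+ 2 - normn (f - f0) ^+ 2) / 2
      - dot e h / n%:R.
  rewrite !sqr_normn -!mulrDl -mulrBl mulrAC -mulrBl; congr (_ / _).
  have -> : f0 + e - fhat = e - (fhat - f0) by rewrite opprB addrCA addrA.
  have -> : f - f0 = (fhat - f0) - h by rewrite /h opprB [RHS]addrC addrA subrK.
  rewrite -[f - fhat]opprB -/h; move: (fhat - f0) (h) => a b.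
  rewrite dotNr !(dotBl, dotBr) (dotC b a).
  by field.
set X := normn (fhat - f0) ^+ 2; set F := normn (f - f0) ^+ 2; set H := normn h.
set DF := norm1 (D *m f); set DH := norm1 (D *m fhat) => kkt.
have H0 : 0 <= H by exact: normn_ge0.
have u0 : 0 <= noise_penalty D S h.
  apply: sumr_ge0 => j _; rewrite mulr_ge0//.
  by rewrite divr_ge0 ?omega_ge0 ?gamma_ge0.
have rho0 : 0 <= rho by exact: normn_ge0.
have noise_h : dot e h / n%:R <= P * H + rho * (lambda0 * noise_penalty D S h).
  apply: le_trans (noise h) _; rewrite lerD2l -mulrA ler_wpM2r//.
  by rewrite mulr_ge0// ltW.
have penalty : noise_penalty D S h + (DF - DH) <= z * H + 2 * norm1 (A *m f).
  have tS : norm1 (rows_of S D *m f) <=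
      norm1 (rows_of S D *m h) + norm1 (rows_of S D *m fhat).
    have -> : rows_of S D *m f = rows_of S D *m fhat - rows_of S D *m h.
      by rewrite -mulmxBr /h opprB addrC subrK.
    by apply: le_trans (ler_norm1D _ _) _; rewrite norm1N addrC.
  have tA : norm1 (A *m h) <= norm1 (A *m fhat) + norm1 (A *m f).
    by rewrite mulmxBr; apply: le_trans (ler_norm1D _ _) _; rewrite norm1N.
  have := compat h; rewrite norm1_weighted -/A -/H.
  rewrite /DF /DH (norm1_rows_of D S f) (norm1_rows_of D S fhat) -/A; lra.
have A0 : 0 <= norm1 (A *m f) by exact: norm1_ge0.
have l_rho0 : 0 <= rho * lambda0 by rewrite mulr_ge0// ltW.
have key : X + H ^+ 2 - F <= 2 * (P + rho * lambda0 * z) * H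
    + 4 * (rho * lambda0) * norm1 (A *m f).
  have := ler_wpM2l l_rho0 penalty; lra.
have k1 : rho * lambda0 <= 2 * sigma * lambda0 by rewrite ler_pM2r.
have k2 : rho * lambda0 * norm1 (A *m f) <= 2 * sigma * lambda0 * norm1 (A *m f).
  exact: ler_wpM2r.
have k3 : rho * lambda0 * z <= 2 * sigma * lambda0 * z by exact: ler_wpM2r.
have slz0 : 0 <= sigma * lambda0 * z by rewrite !mulr_ge0// ltW.
have slA0 : 0 <= sigma * lambda0 * norm1 (A *m f) by rewrite !mulr_ge0// ltW.
set b := P + rho * lambda0 * z.
have b0 : 0 <= b by rewrite addr_ge0// mulr_ge0.
have bb : b <= sigma * (p + 4 * lambda0 * z) by rewrite /b; lra.
have b2 : b ^+ 2 <= sigma ^+ 2 * (p + 4 * lambda0 * z) ^+ 2.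
  by rewrite -exprMn ler_pXn2r// nnegrE//; apply: le_trans bb.
have := sqr_ge0 (H - b); rewrite -/b in key.
rewrite sqrrB; lra.
Qed.

(** * The probabilistic events *)

(** Since <e, A^+ A h> is the sum of <d_i^+, e> (A h)_i over the columns [d_i^+] of
the pseudoinverse, scaling these by [omega_i] puts it in the form of
[gaussian_weighted_l1] with vectors of squared length at most [1 / n].  The
choice of [u] brings the failure probability down to [exp (- t)]. *)
Lemma penalized_noise_event (R : realType) (d : measure_display) (T : measurableType d)
    (P : probability T R) (m n : nat) (sigma : R) (eps : 'I_n -> {RV P >-> R})
    (D : 'M[R]_(m, n)) (S : {set 'I_m}) (r t eta lambda0 : R) :
  0 < sigma -> gaussian_noise sigma eps ->
  r = (nulldim D S)%:R -> 0 < t < (n%:R - 1) / 2 - ln (2 * (n%:R - r)) ->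
  eta < 1 ->
  1 / (1 - eta) * gamma D S
    * Num.sqrt ((2 * ln (2 * (n%:R - r)) + 2 * t) / (n%:R - 1)) <= lambda0 ->
  exists B : set T, [/\ measurable B, (P B <= (expR (- t))%:E)%E &
    forall x, ~ B x -> forall h : 'cV[R]_n,
      dot (\col_j eps j x)
        (Defs.pinv (rows_of (~: S)%SET D) *m (rows_of (~: S)%SET D *m h)) / n%:R <=
      (1 - eta) * sigma * lambda0 * noise_penalty D S h].
Proof.
move=> s0 Heps rE /andP[t0 tlt] eta1 Hl.
set A := rows_of (~: S)%SET D.
have nr : n%:R - r = (\rank A)%:R by rewrite rE nulldim_rank.
rewrite nr in tlt Hl.
pose p : R := (\rank A)%:R; rewrite -/p in tlt Hl.
(* As [ln 0 = 0], this includes the case of a zero matrix [A]. *)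
have ln0 : 0 <= ln (2 * p).
  rewrite /p; case: (\rank A) => [|k]; first by rewrite mulr0 ln0.
  by rewrite ln_ge0// -natrM ler1n.
have n1 : 0 < n%:R - 1 :> R by lra.
have n0 : 0 < n%:R :> R by lra.
have sn0 : 0 < Num.sqrt n%:R :> R by rewrite sqrtr_gt0.
pose u := Num.sqrt (2 * ln (2 * p) + 2 * t).
have u2 : u ^+ 2 = 2 * ln (2 * p) + 2 * t by rewrite sqr_sqrtr//; lra.
have u0 : 0 < u by rewrite sqrtr_gt0; lra.
pose w (j : 'I_#|(~: S)%SET|) := omega D S (enum_val j).
pose v j := (w j * n%:R)^-1 *: col j (Defs.pinv A).
pose C := diag_mx (\row_j w j) *m A.
have rkC : (\rank C)%:R <= p by rewrite ler_nat mxrankM_maxr.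
have sqw j : w j ^+ 2 = dot (col j (Defs.pinv A)) (col j (Defs.pinv A)) / n%:R.
  by rewrite /w omega_enum_val sqr_normn.
have vle j : dot (v j) (v j) <= (Num.sqrt n%:R)^-1 ^+ 2.
  rewrite dotZl dotZr exprVn (sqr_sqrtr (ltW n0)).
  have [wj0|wj0] := eqVneq (w j) 0.
    by rewrite wj0 !mul0r invr0 !mul0r invr_ge0 ltW.
  rewrite -[dot _ _](divfK (lt0r_neq0 n0)) -sqw.
  rewrite le_eqVlt; apply/orP; left; apply/eqP.
  by field; rewrite wj0 gt_eqF.
have sni : 0 < (Num.sqrt n%:R)^-1 :> R by rewrite invr_gt0.
have [B [mB PB HB]] := gaussian_weighted_l1 s0 Heps sni u0 rkC vle.
exists B; split => //.
  apply: le_trans PB _; rewrite lee_fin u2.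
  have [p0|p0] := eqVneq p 0; first by rewrite p0 mulr0 mul0r expR_ge0.
  have p0' : 0 < 2 * p by rewrite mulr_gt0// lt_def p0 ler0n.
  rewrite (_ : - (_ / 2) = - ln (2 * p) - t); last by field.
  by rewrite expRD expRN lnK ?posrE// mulrA divff ?gt_eqF// mul1r.
move=> x Bx h.
have CE j : (C *m h) j 0 = w j * (A *m h) j 0.
  by rewrite /C -mulmxA mul_diag_mx !mxE.
have -> : dot (\col_j eps j x) (Defs.pinv A *m (A *m h)) / n%:R =
    \sum_j dot (v j) (\col_j eps j x) * (C *m h) j 0.
  rewrite dot_mulmx /dot mulr_suml; apply: eq_bigr => j _.
  rewrite CE -/(dot (v j) (\col_j eps j x)) dotZl.
  have -> : ((Defs.pinv A)^T *m \col_j eps j x) j 0 =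
      dot (col j (Defs.pinv A)) (\col_j eps j x).
    by rewrite mxE; apply: eq_bigr => i _; rewrite !mxE.
  have [wj0|wj0] := eqVneq (w j) 0; last by field; rewrite wj0 gt_eqF.
  have -> : col j (Defs.pinv A) = 0.
    apply/eqP; rewrite -dot_eq0; have /esym/eqP := sqw j.
    by rewrite wj0 expr0n mulf_eq0 invr_eq0 (gt_eqF n0) orbF.
  by rewrite wj0 /dot big1 ?(mul0r, mulr0)// => i _; rewrite mxE mul0r.
apply: le_trans (HB x Bx h) _.
have -> : \sum_i `|(C *m h) i 0| = gamma D S * noise_penalty D S h.
  rewrite /noise_penalty mulr_sumr; apply: eq_bigr => j _.
  rewrite CE normrM (ger0_norm (omega_ge0 _ _ _)) mulrA -omega_gammaE//.
  exact: enum_valP.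
have u0' : 0 <= noise_penalty D S h.
  apply: sumr_ge0 => j _; rewrite mulr_ge0//.
  by rewrite divr_ge0 ?omega_ge0 ?gamma_ge0.
rewrite mulrA ler_wpM2r//.
rewrite [leRHS](_ : _ = sigma * ((1 - eta) * lambda0)); last by ring.
rewrite -!mulrA ler_pM2l// mulrA.
have eta0 : 0 < 1 - eta by lra.
apply: le_trans (ler_wpM2l (ltW eta0) Hl).
rewrite !mulrA mulr1 mulfV ?gt_eqF// !mul1r mulrC ler_wpM2l ?gamma_ge0//.
rewrite sqrtrM; last by lra.
rewrite -/u mulrC ler_wpM2l ?(ltW u0)// sqrtrV ?(ltW n1)//.
rewrite lef_pV2 ?posrE ?sqrtr_gt0//; apply: ler_wsqrtr; lra.
Qed.

Lemma projected_noise (R : realType) (k n : nat) (A : 'M[R]_(k, n)) (e h : 'cV[R]_n) :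
  dot e h / n%:R <= normn (null_proj A *m e) * normn h
    + dot e (Defs.pinv A *m (A *m h)) / n%:R.
Proof.
have -> : dot e h = dot (null_proj A *m e) h + dot e (Defs.pinv A *m (A *m h)).
  rewrite -{1}null_proj_tr -dot_mulmx -dotDr; congr dot.
  by rewrite mulmxBl mul1mx mulmxA subrK.
by rewrite mulrDl lerD2r dot_le_normn.
Qed.

Lemma gaussian_projection_event (R : realType) (d : measure_display)
    (T : measurableType d) (P : probability T R) (n k : nat) (sigma : R)
    (eps : 'I_n -> {RV P >-> R}) (Pi : 'M[R]_n) (a : R) :
  0 < sigma -> gaussian_noise sigma eps -> 0 < a -> (0 < n)%N ->
  Pi^T = Pi -> Pi *m Pi = Pi -> (\rank Pi <= k)%N ->
  exists B : set T, [/\ measurable B, (P B <= (expR (- a))%:E)%E &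
    forall x, ~ B x -> normn (Pi *m \col_i eps i x) <=
      sigma * ((Num.sqrt k%:R + Num.sqrt (2 * a)) / Num.sqrt n%:R)].
Proof.
move=> s0 Heps a0 n0 PiT PiPi rk.
have [qs [oqs sqs _ qsE]] := projection_orthonormal PiT PiPi.
have [B [mB PB HB]] := gaussian_proj_tail s0 Heps oqs a0.
exists B; split => // x Bx.
have sn0 : 0 < Num.sqrt n%:R :> R by rewrite sqrtr_gt0 ltr0n.
rewrite -(@ler_pXn2r _ 2)// ?nnegrE ?normn_ge0//; last first.
  by rewrite mulr_ge0 ?(ltW s0)// divr_ge0 ?(ltW sn0)// addr_ge0 ?sqrtr_ge0.
rewrite sqr_normn dot_mulmx PiT mulmxA PiPi dotC qsE.
rewrite mulrA exprMn exprVn (@sqr_sqrtr _ n%:R (ler0n _ _)) ler_pM2r ?invr_gt0 ?ltr0n//.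
apply: le_trans (HB x Bx) _.
rewrite ler_pXn2r ?nnegrE ?mulr_ge0 ?addr_ge0 ?sqrtr_ge0 ?(ltW s0)//.
rewrite ler_pM2l// lerD2r; apply: ler_wsqrtr.
by rewrite ler_nat (leq_trans sqs).
Qed.

(** Consequences of the choice of the constants.  All square roots reduce to
those of [n], [r], [2 a] and [1 - q]; in particular [q <= 2 p < eta]. *)
Lemma threshold_constants (R : realType) (n r a eta c : R) :
  0 < a -> 0 < eta < 1 -> 8 * a < n ->
  let q := Num.sqrt (8 * a / n) in
  let p := (Num.sqrt r + Num.sqrt (2 * a)) / Num.sqrt (n - Num.sqrt (8 * a * n)) in
  c = Num.sqrt ((eta / 2 - p) ^+ 2 + 4) - 2 ->
  2 * p < eta ->
  [/\ [/\ 0 < 1 - q, 0 <= p & Num.sqrt (2 * a) / Num.sqrt n <= 2^-1],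
      (Num.sqrt r + Num.sqrt (2 * a)) / Num.sqrt n = p * Num.sqrt (1 - q),
      1 - eta <= (1 - eta / 2) * Num.sqrt (1 - q) &
      [/\ 0 <= c, 4 * c <= (eta / 2 - p) ^+ 2 & c <= 16^-1]].
Proof.
move=> a0 /andP[eta0 eta1] an q p cE pe.
have n0 : 0 < n by lra.
set sa := Num.sqrt (2 * a) in p pe cE *; set sr := Num.sqrt r in p pe cE *.
have sa0 : 0 < sa by rewrite sqrtr_gt0; lra.
have sr0 : 0 <= sr by exact: sqrtr_ge0.
set sn := Num.sqrt n.
have sn0 : 0 < sn by rewrite sqrtr_gt0.
have sn2 : sn ^+ 2 = n by rewrite sqr_sqrtr ?ltW.
have sqrt4 : Num.sqrt 4 = 2 :> R.
  by rewrite (_ : 4 = 2 ^+ 2) ?sqrtr_sqr ?ger0_norm//; ring.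
have qE : q = 2 * (sa / sn).
  rewrite /q (_ : 8 * a / n = 4 * ((2 * a) / n)); last by field; rewrite gt_eqF.
  rewrite sqrtrM// sqrt4 sqrtrM; last by lra.
  by rewrite sqrtrV// ltW.
have q0 : 0 < q by rewrite qE mulr_gt0// divr_gt0.
have q1 : q < 1.
  by rewrite -sqrtr1 ltr_sqrt// ltr_pdivrMr// mul1r.
have w0 : 0 < 1 - q by lra.
have nq : Num.sqrt (8 * a * n) = n * q.
  rewrite (_ : 8 * a * n = n ^+ 2 * (8 * a / n)); last by field; rewrite gt_eqF.
  by rewrite sqrtrM ?sqr_ge0// sqrtr_sqr gtr0_norm.
set w := Num.sqrt (1 - q).
have wgt0 : 0 < w by rewrite sqrtr_gt0.
have w2 : w ^+ 2 = 1 - q by rewrite sqr_sqrtr ?ltW.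
have w1 : w <= 1.
  by rewrite -sqrtr1; apply: ler_wsqrtr; lra.
have pE : p = (sr + sa) / (sn * w).
  by rewrite /p nq (_ : n - n * q = n * (1 - q)) ?sqrtrM ?ltW//; ring.
have p0 : 0 <= p by rewrite pE divr_ge0 ?addr_ge0 ?mulr_ge0// ltW.
have pw : (sr + sa) / sn = p * w by rewrite pE; field; rewrite !gt_eqF.
have qp : q <= 2 * p.
  rewrite qE ler_pM2l//; apply: (@le_trans _ _ (p * w)); last first.
    by rewrite ler_piMr.
  by rewrite -pw ler_pM2r ?invr_gt0// lerDr.
split => //.
- by split => //; lra.
- have h0 : 0 <= (1 - eta / 2) * w by rewrite mulr_ge0 ?(ltW wgt0)//; lra.
  rewrite -(@ler_pXn2r _ 2)// ?nnegrE//; last by lra.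
  rewrite exprMn w2; apply: (@le_trans _ _ ((1 - eta / 2) ^+ 2 * (1 - eta))).
    by have := sqr_ge0 (eta / 2); nra.
  by rewrite ler_wpM2l ?sqr_ge0//; lra.
- set x := eta / 2 - p in cE *.
  have x2 : 0 <= x ^+ 2 by exact: sqr_ge0.
  have c0 : 2 <= Num.sqrt (x ^+ 2 + 4) by rewrite -[leLHS]sqrt4; apply: ler_wsqrtr; lra.
  have c1 : Num.sqrt (x ^+ 2 + 4) <= 2 + x ^+ 2 / 4.
    rewrite -(@ler_pXn2r _ 2)// ?nnegrE ?sqrtr_ge0//; last by lra.
    rewrite sqr_sqrtr; last by lra.
    by have := sqr_ge0 (x ^+ 2); nra.
  have x1 : x ^+ 2 <= 4^-1.
    have : 0 <= (2^-1 - x) * (2^-1 + x) by apply: mulr_ge0; rewrite /x; lra.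
    by lra.
  by split; rewrite cE; lra.
Qed.

Lemma probability_setCU4 (R : realType) (d : measure_display) (T : measurableType d)
    (P : probability T R) (B1 B2 B3 B4 : set T) (b1 b2 b3 b4 : R) :
  measurable B1 -> measurable B2 -> measurable B3 -> measurable B4 ->
  (P B1 <= b1%:E)%E -> (P B2 <= b2%:E)%E -> (P B3 <= b3%:E)%E -> (P B4 <= b4%:E)%E ->
  ((1 - (b1 + b2 + b3 + b4))%:E <= P (~` (B1 `|` B2 `|` B3 `|` B4)))%E.
Proof.
move=> m1 m2 m3 m4 h1 h2 h3 h4.
have m12 := measurableU _ _ m1 m2; have m123 := measurableU _ _ m12 m3.
rewrite probability_setC; last exact: measurableU.
rewrite EFinB; apply: leeB => //; rewrite !EFinD.
apply: le_trans (measureU2 _ _ _) _ => //; apply: leeD => //.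
apply: le_trans (measureU2 _ _ _) _ => //; apply: leeD => //.
by apply: le_trans (measureU2 _ _ _) _ => //; apply: leeD.
Qed.

Unset Implicit Arguments.

Theorem theorem3p1 (R : realType) (d : measure_display) (T : measurableType d)
    (P : probability T R) (m n : nat) (sigma : R) (f0 : 'cV[R]_n)
    (eps : 'I_n -> {RV P >-> R}) (Y : T -> 'cV[R]_n)
    (hsigma : 0 < sigma)
    (heps : gaussian_noise sigma eps)
    (hY : forall x, Y x = f0 + \col_i eps i x)
    (D : 'M[R]_(m, n)) (S : {set 'I_m}) (hS : S \in active_sets D)
    (r : R) (hr : r = (nulldim D S)%:R)
    (a eta t lambda0 c : R)
    (ha : 0 < a) (heta : 0 < eta < 1)
    (ht : 0 < t < (n%:R - 1) / 2 - ln (2 * (n%:R - r)))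
    (hlambda0 : 0 < lambda0)
    (hlambda0_gamma : 1 / (1 - eta) * gamma D S
        * Num.sqrt ((2 * ln (2 * (n%:R - r)) + 2 * t) / (n%:R - 1)) <= lambda0)
    (hn : 8 * a < n%:R)
    (hlambda0_R : exists2 R0 : R, 0 < R0 & R0 / (1 - eta) <= lambda0)
    (hc : c = Num.sqrt ((eta / 2 - (Num.sqrt r + Num.sqrt (2 * a))
                           / Num.sqrt (n%:R - Num.sqrt (8 * a * n%:R))) ^+ 2
                        + 4) - 2)
    (hf0 : norm1 (D *m f0)
           <= c * sigma * Num.sqrt (1 - Num.sqrt (8 * a / n%:R)) / lambda0)
    (heta_S : 2 * ((Num.sqrt r + Num.sqrt (2 * a))
                   / Num.sqrt (n%:R - Num.sqrt (8 * a * n%:R))) < eta)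
    (fhat : T -> 'cV[R]_n)
    (hfhat : forall x, is_sqrt_analysis D lambda0 (Y x) (fhat x))
    (f : 'cV[R]_n) :
  holds_with_prob_ge P (1 - 4 * expR (- a) - expR (- t))
    [set x | ((normn (fhat x - f0) ^+ 2)%:E
      <= (normn (f - f0) ^+ 2
          + 16 * sigma * lambda0 * norm1 (rows_of (~: S)%SET D *m f))%:E
         + (sigma ^+ 2)%:E
           * ((Num.sqrt (2 * a / n%:R) + Num.sqrt (r / n%:R))%:E
              + (4 * lambda0 * Num.sqrt r)%:E / kappa D S (weights D S))
             ^+ 2)%E].
Proof.
have n0 : 0 < n%:R :> R by lra.
have nn0 : (0 < n)%N by rewrite -(ltr0n R).
have [eta0 eta1] := andP heta.
have [[w0 p0 sa12] pE etaw [c0 c4 c16]] := threshold_constants ha heta hn hc heta_S.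
move: hf0 c4 heta_S p0 pE w0 etaw.
set q := Num.sqrt (8 * a / n%:R); set p := _ / Num.sqrt (n%:R - _).
move=> hf0' c4 pe p0 pE w0 etaw.
set w := Num.sqrt (1 - q) in hf0' pE etaw.
have wgt0 : 0 < w by rewrite sqrtr_gt0.
set A := rows_of (~: S)%SET D.
have [B1 [mB1 PB1 HB1]] := gaussian_norm_lower_tail hsigma heps ha hn.
(* The identity is a projection of rank [n], so its event bounds the norm of the
   noise from above. *)
have [B2 [mB2 PB2 HB2]] : exists B : set T, [/\ measurable B,
    (P B <= (expR (- a))%:E)%E &
    forall x, ~ B x -> normn (1%:M *m \col_i eps i x) <=
      sigma * ((Num.sqrt n%:R + Num.sqrt (2 * a)) / Num.sqrt n%:R)].
  apply: gaussian_projection_event => //; last by rewrite mxrank1.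
  - exact: trmx1.
  - exact: mul1mx.
have [B3 [mB3 PB3 HB3]] := gaussian_projection_event hsigma heps ha nn0
  (null_proj_tr A) (null_proj_idem A) (rank_null_proj D S).
rewrite -hr in HB3.
have [B4 [mB4 PB4 HB4]] :=
  penalized_noise_event hsigma heps hr ht eta1 hlambda0_gamma.
exists (~` (B1 `|` B2 `|` B3 `|` B4)); split.
- by apply: measurableC; do !apply: measurableU.
- move=> x /= /not_orP[/not_orP[/not_orP[/HB1 h1 /HB2 h2] /HB3 h3] /HB4 h4].
  set e := \col_i eps i x in h1 h2 h3 h4.
  rewrite mul1mx in h2.
  have Hmin : is_sqrt_analysis D lambda0 (f0 + e) (fhat x) by rewrite -hY.
  have e_low : sigma * w <= normn e.
    rewrite -(@ler_pXn2r _ 2)// ?nnegrE ?normn_ge0//; last first.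
      by rewrite mulr_ge0// ltW.
    rewrite exprMn sqr_sqrtr ?(ltW w0)// sqr_normn ler_pdivlMr//.
    by rewrite -mulrA [_ * n%:R]mulrC.
  have sw0 : 0 < sigma * w by rewrite mulr_gt0.
  have e0 : 0 < normn e by apply: lt_le_trans e_low.
  have e_up : normn e <= 3 / 2 * sigma.
    apply: le_trans h2 _; rewrite mulrDl divff ?gt_eqF ?sqrtr_gt0// mulrC.
    by rewrite ler_pM2r//; lra.
  have noise h : dot e h / n%:R <= normn (null_proj A *m e) * normn h
      + (1 - eta) * sigma * lambda0 * noise_penalty D S h.
    by apply: le_trans (projected_noise A e h) _; rewrite lerD2l.
  have Pp : normn (null_proj A *m e) <= p * normn e.
    apply: le_trans h3 _; rewrite pE mulrCA; exact: ler_wpM2l.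
  have hb : lambda0 * norm1 (D *m f0) <= c * normn e.
    rewrite mulrC -ler_pdivlMr//; apply: le_trans hf0' _.
    rewrite ler_pM2r ?invr_gt0// -mulrA; exact: ler_wpM2l.
  have se : (1 - eta) * sigma <= (1 - eta / 2) * normn e.
    apply: (@le_trans _ _ ((1 - eta / 2) * w * sigma)); first by rewrite ler_pM2r.
    by rewrite -mulrA [w * _]mulrC ler_wpM2l//; lra.
  have pe' : p < eta / 2 by lra.
  have r_low := residual_lower hlambda0 hsigma heta Hmin noise e0 se Pp p0 pe' c4 hb.
  have r_up : normn (f0 + e - fhat x) <= 2 * sigma.
    have := Hmin f0; rewrite /sqrt_analysis_objective [f0 + e - f0]addrAC subrr add0r.
    have : 0 <= lambda0 * norm1 (D *m fhat x).
      by rewrite mulr_ge0 ?norm1_ge0// ltW.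
    have : c * normn e <= 16^-1 * normn e by rewrite ler_pM2r.
    by lra.
  have := compatibility (weights D S) hS hlambda0.
  rewrite /= -hr => -[->|[z [z0 ->] compat]].
    rewrite addey// mulyy gt0_muley ?lte_fin ?exprn_gt0// addey//.
    by rewrite leey.
  rewrite -!(EFinD, EFinM) -expr2 lee_fin.
  apply: (oracle_inequality f hlambda0 hsigma eta1 Hmin noise) => //.
  + by rewrite r_up andbT (le_trans se).
  + rewrite normn_ge0; apply: le_trans h3 _; rewrite ler_pM2l//.
    rewrite mulrDl addrC !sqrtrM ?sqrtrV ?(ltW n0)//; last by lra.
    by rewrite hr.
- apply: le_trans (probability_setCU4 mB1 mB2 mB3 mB4 PB1 PB2 PB3 PB4).
  rewrite lee_fin; have := expR_ge0 (- a); lra.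
Qed.
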